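(* For every prime $p$ there exist finitely generated, linear, residually $p$, and boundedly generated groups $K\leq H$ such that $[H:K]$ is finite and coprime to $p$, $K$ is dense in $H$ for the pro-$p$ topology of $H$, the natural map $\widehat K_p\to\widehat H_p$ is surjective but not injective, and such that, for $\Gamma=H*_K H$, the following hold: $\Gamma$ is finitely generated and residually finite but not residually $p$; $\widehat\Gamma_p\cong\widehat H_p$ is boundedly generated; and the full profinite completion $\widehat\Gamma$ is not boundedly generated.
   Context: An abstract group $G$ is boundedly generated if $G=\langle g_1\rangle\cdots\langle g_d\rangle$ for finitely many $g_1,\dots,g_d\in G$. A profinite group $G$ is boundedly generated if $G=\overline{\langle g_1\rangle}\cdots\overline{\langle g_d\rangle}$ for finitely many $g_1,\dots,g_d\in G$. $\widehat G$ and $\widehat G_p$ denote the profinite and pro-$p$ completions of an abstract group $G$. $G$ is residually finite if $G\to\widehat G$ is injective, and residually $p$ if $G\to\widehat G_p$ is injective. The pro-$p$ topology on $H$ has the normal subgroups of finite $p$-power index as a base of neighbourhoods of $1$. $H*_K H$ is the amalgamated free product of two copies of $H$ with the two copies of $K$ identified by the identity. *)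

(* Defs.v *)
From HB Require Import structures.
From mathcomp Require Import all_boot all_order all_algebra.
From mathcomp Require fingroup.
From mathcomp Require Import all_classical topology.

Set Implicit Arguments.
Unset Strict Implicit.
Unset Printing Implicit Defensive.

Local Open Scope classical_set_scope.
Local Open Scope card_scope.
Local Open Scope group_scope.

Section Subsets.
Variable G : groupType.
Implicit Types (A B S : set G) (x y : G).

Definition setM A B : set G := [set x * y | x in A & y in B].

Definition is_subgroup S : Prop := group_closed [pred x | x \in S].

Definition gen A : set G := smallest is_subgroup A.

Definition lcoset S x : set G := [set x * y | y in S].

Definition lcosets S : set (set G) := range (lcoset S).

Definition has_index S (n : nat) : Prop := lcosets S #= `I_n.

End Subsets.

Record subgroup (G : groupType) := Subgroup {
  sg_set :> set G;
  sg_closed : is_subgroup sg_set }.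

HB.instance Definition _ (G : groupType) (K : subgroup G) :=
  SubChoice.on (set_type (sg_set K)).
HB.instance Definition _ (G : groupType) (K : subgroup G) :=
  SubChoice_isSubGroup.Build G _ (set_type (sg_set K)) (sg_closed K).

Definition sg_incl (G : groupType) (K : subgroup G) : K -> G := val.

HB.instance Definition _ (G : groupType) (K : subgroup G) :=
  isMultiplicative.Build K G (@sg_incl G K) (@valM _ _ _).

Section SubgroupTheory.
Variables (G : groupType) (K : subgroup G).

Lemma sg1 : sg_set K 1.
Proof. by have [/set_mem] := sg_closed K. Qed.

Lemma sgF x y : sg_set K x -> sg_set K y -> sg_set K (x * y^-1).
Proof.
by move=> Kx Ky; apply/set_mem; apply: (sg_closed K).2; apply/mem_set.
Qed.

Lemma sgV x : sg_set K x -> sg_set K x^-1.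
Proof. by move=> Kx; rewrite -div1g; apply: sgF sg1 Kx. Qed.

Lemma sgM x y : sg_set K x -> sg_set K y -> sg_set K (x * y).
Proof. by move=> Kx /sgV Ky; rewrite -[y]invgK; apply: sgF. Qed.

Lemma lcosetP x y : lcoset K x y <-> sg_set K (x^-1 * y).
Proof.
split=> [[z Kz <-]|Kz]; first by rewrite mulKg.
by exists (x^-1 * y); rewrite ?mulVKg.
Qed.

Lemma lcoset_eq x y : lcoset K x = lcoset K y <-> sg_set K (x^-1 * y).
Proof.
split=> [e|Kxy].
  by apply/lcosetP; rewrite e; apply/lcosetP; rewrite mulVg; apply: sg1.
apply/seteqP; split=> z /lcosetP Kz; apply/lcosetP.
  by have := sgM (sgV Kxy) Kz; rewrite invgM invgK -mulgA mulVKg.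
by have := sgM Kxy Kz; rewrite -mulgA mulVKg.
Qed.

End SubgroupTheory.

Record normal_subgroup (G : groupType) := NormalSubgroup {
  ns_sg :> subgroup G;
  ns_normal : forall x y, sg_set ns_sg x -> sg_set ns_sg (x ^ y) }.

HB.mixin Record isTopGroup G of Group G & Topological G := {
  mulg_continuous : continuous (fun x : G * G => x.1 * x.2);
  invg_continuous : continuous (fun x : G => x^-1) }.

#[short(type="topGroupType")]
HB.structure Definition TopGroup :=
  {G of isTopGroup G & Group G & Topological G}.

Section Quotient.
Variables (G : groupType) (N : normal_subgroup G).

Definition quot : Type := set_type (lcosets N).

HB.instance Definition _ := Choice.on quot.
HB.instance Definition _ :=
  Topological.copy quot (discrete_topology (set_type (lcosets N))).
HB.instance Definition _ := Discrete_ofNbhs.Build quot erefl.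

Definition coset (x : G) : quot := SigSub (mem_set (imageT (lcoset N) x)).

Lemma coset_surj (c : quot) : exists x, c = coset x.
Proof.
by case: c => C C_; have [x _ xC] := set_mem C_; exists x; apply/val_inj.
Qed.

Lemma coset_eq x y : coset x = coset y <-> sg_set N (x^-1 * y).
Proof.
rewrite -lcoset_eq; split=> [e|e]; last exact/val_inj.
exact: (congr1 val e).
Qed.

Lemma setM_lcoset x y : setM (lcoset N x) (lcoset N y) = lcoset N (x * y).
Proof.
apply/seteqP; split=> [_ [a [m Nm <-] [b [n Nn <-] <-]]|_ [n Nn <-]].
  exists (m ^ y * n); first exact: sgM (ns_normal _ Nm) Nn.
  by rewrite conjgE !mulgA mulgK.
exists x; first by exists 1; [apply: sg1|rewrite mulg1].
by exists (y * n); [exists n|rewrite mulgA].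
Qed.

Lemma invg_lcoset x : [set y^-1 | y in lcoset N x] = lcoset N x^-1.
Proof.
apply/seteqP; split=> [_ [_ [n Nn <-] <-]|_ [n Nn <-]].
  exists (n^-1 ^ x^-1); first exact/ns_normal/sgV.
  by rewrite conjgE invgK mulKg invgM.
exists (x * n^-1 ^ x); first by exists (n^-1 ^ x) => //; apply/ns_normal/sgV.
by rewrite conjgE mulVKg invgM invgK.
Qed.

Fact quot_mul_subproof (c d : quot) : setM (val c) (val d) \in lcosets N.
Proof.
have [x ->] := coset_surj c; have [y ->] := coset_surj d.
by apply/mem_set; rewrite setM_lcoset; apply: imageT.
Qed.

Fact quot_inv_subproof (c : quot) : [set x^-1 | x in val c] \in lcosets N.
Proof.
have [x ->] := coset_surj c.
by apply/mem_set; rewrite invg_lcoset; apply: imageT.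
Qed.

Definition quot_mul (c d : quot) : quot := SigSub (quot_mul_subproof c d).
Definition quot_inv (c : quot) : quot := SigSub (quot_inv_subproof c).

Lemma quot_mulE x y : quot_mul (coset x) (coset y) = coset (x * y).
Proof. exact/val_inj/setM_lcoset. Qed.

Lemma quot_invE x : quot_inv (coset x) = coset x^-1.
Proof. exact/val_inj/invg_lcoset. Qed.

Fact quot_mulA : associative quot_mul.
Proof.
move=> c d e; have [x ->] := coset_surj c; have [y ->] := coset_surj d.
by have [z ->] := coset_surj e; rewrite !quot_mulE mulgA.
Qed.

Fact quot_mul1g : left_id (coset 1) quot_mul.
Proof. by move=> c; have [x ->] := coset_surj c; rewrite quot_mulE mul1g. Qed.

Fact quot_mulg1 : right_id (coset 1) quot_mul.
Proof. by move=> c; have [x ->] := coset_surj c; rewrite quot_mulE mulg1. Qed.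

Fact quot_mulVg : left_inverse (coset 1) quot_inv quot_mul.
Proof.
by move=> c; have [x ->] := coset_surj c; rewrite quot_invE quot_mulE mulVg.
Qed.

Fact quot_mulgV : right_inverse (coset 1) quot_inv quot_mul.
Proof.
by move=> c; have [x ->] := coset_surj c; rewrite quot_invE quot_mulE mulgV.
Qed.

HB.instance Definition _ := isGroup.Build quot
  quot_mulA quot_mul1g quot_mulg1 quot_mulVg quot_mulgV.

Lemma cosetM x y : coset (x * y) = coset x * coset y.
Proof. by rewrite -quot_mulE. Qed.

End Quotient.

Section DiscreteTopGroup.
Variables (G : groupType) (N : normal_subgroup G).
Local Notation Q := (quot N).

Lemma discrete_pair_nbhs (x : Q * Q) : nbhs x [set x].
Proof.
exists ([set x.1], [set x.2]); first by split; apply: discrete_set1.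
by move=> [a b] [/= -> ->]; case: x.
Qed.

Fact quot_mulg_continuous : continuous (fun x : Q * Q => x.1 * x.2).
Proof.
move=> x A /nbhs_singleton Ax; apply: filterS (discrete_pair_nbhs x).
by move=> _ ->.
Qed.

Fact quot_invg_continuous : continuous (fun x : Q => x^-1).
Proof.
move=> x A /nbhs_singleton Ax; apply: (@filterS _ (nbhs x) _ [set x]);
  last exact: discrete_set1.
by move=> _ ->.
Qed.

HB.instance Definition _ :=
  isTopGroup.Build Q quot_mulg_continuous quot_invg_continuous.

End DiscreteTopGroup.

Section ProductTopGroup.
Variables (I : eqType) (T : I -> topGroupType).
Local Notation P := (prod_topology T).

Let prodP (x y : P) : (forall i, x i = y i) -> x = y.
Proof. exact: functional_extensionality_dep. Qed.

Let one : P := fun=> 1.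
Let mul (x y : P) : P := fun i => x i * y i.
Let inv (x : P) : P := fun i => (x i)^-1.

Let mulA : associative mul.
Proof. by move=> x y z; apply: prodP => i; apply: mulgA. Qed.
Let mul1 : left_id one mul.
Proof. by move=> x; apply: prodP => i; apply: mul1g. Qed.
Let mulr1 : right_id one mul.
Proof. by move=> x; apply: prodP => i; apply: mulg1. Qed.
Let mulV : left_inverse one inv mul.
Proof. by move=> x; apply: prodP => i; apply: mulVg. Qed.
Let mulrV : right_inverse one inv mul.
Proof. by move=> x; apply: prodP => i; apply: mulgV. Qed.

HB.instance Definition _ := isGroup.Build P mulA mul1 mulr1 mulV mulrV.

Lemma prod_cvg (U : Type) (F : set_system U) (f : U -> P) (l : P) :
  Filter F -> (forall i, f x i @[x --> F] --> l i) -> f x @[x --> F] --> l.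
Proof.
move=> FF cf; apply/cvg_sup => i A [_ [[B oB <-] /= Bl] BA].
apply: filterS BA _; apply: cf; exact: open_nbhs_nbhs.
Qed.

Lemma prod_proj_cvg (U : Type) (F : set_system U) (f : U -> P) (l : P) i :
  Filter F -> f x @[x --> F] --> l -> f x i @[x --> F] --> l i.
Proof.
by move=> FF cf; exact: (@cvg_comp _ _ _ f (fun y : P => y i) _ _ _ cf
  (@proj_continuous I T i l)).
Qed.

Fact prod_mulg_continuous : continuous (fun x : P * P => x.1 * x.2).
Proof.
move=> x; apply: prod_cvg => i.
apply: (@continuous2_cvg _ _ _ _ _ _ (fun x : P * P => x.1 i) (fun x => x.2 i)
  (fun a b => a * b)).
- exact: (@mulg_continuous (T i) (x.1 i, x.2 i)).
- apply: prod_proj_cvg; exact: cvg_fst.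
- apply: prod_proj_cvg; exact: cvg_snd.
Qed.

Fact prod_invg_continuous : continuous (fun x : P => x^-1).
Proof.
move=> x; apply: (@prod_cvg _ (nbhs x) _ _ (nbhs_filter x)) => i.
apply: (@continuous_cvg _ _ _ (nbhs x) _ (fun y : P => y i)
  (fun a : T i => a^-1)); first exact: invg_continuous.
exact: (@prod_proj_cvg _ (nbhs x) idfun x i (nbhs_filter x)).
Qed.

HB.instance Definition _ :=
  isTopGroup.Build P prod_mulg_continuous prod_invg_continuous.

End ProductTopGroup.

Section SubTopGroup.
Variables (G : topGroupType) (K : subgroup G).
Local Notation S := (set_type (sg_set K)).

Lemma sub_cvg (U : Type) (F : set_system U) (f : U -> S) (l : S) :
  Filter F -> val (f x) @[x --> F] --> val l -> f x @[x --> F] --> l.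
Proof.
move=> FF cf A [_ [[B oB <-] /= Bl] BA].
apply: filterS BA _; apply: cf; exact: open_nbhs_nbhs.
Qed.

Lemma val_cvg (U : Type) (F : set_system U) (f : U -> S) (l : S) :
  Filter F -> f x @[x --> F] --> l -> val (f x) @[x --> F] --> val l.
Proof.
by move=> FF cf; exact: (@cvg_comp _ _ _ f (val : S -> G) _ _ _ cf
  (@initial_continuous S G val l)).
Qed.

Fact sub_mulg_continuous : continuous (fun x : S * S => x.1 * x.2).
Proof.
move=> x; apply: sub_cvg.
apply: (@continuous2_cvg _ _ _ _ _ _ (fun x : S * S => val x.1)
  (fun x => val x.2) (fun a b => a * b)).
- exact: (@mulg_continuous G (val x.1, val x.2)).
- apply: val_cvg; exact: cvg_fst.
- apply: val_cvg; exact: cvg_snd.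
Qed.

Fact sub_invg_continuous : continuous (fun x : S => x^-1).
Proof.
move=> x; apply: (@sub_cvg _ (nbhs x) _ _ (nbhs_filter x)).
apply: (@continuous_cvg _ _ _ (nbhs x) _ (fun y : S => val y)
  (fun a : G => a^-1)); first exact: invg_continuous.
exact: (@val_cvg _ (nbhs x) idfun x (nbhs_filter x)).
Qed.

HB.instance Definition _ :=
  isTopGroup.Build S sub_mulg_continuous sub_invg_continuous.

End SubTopGroup.

Section FiniteIndex.

Lemma mulf1 (G H : groupType) (f : {multiplicative G -> H}) : f 1 = 1.
Proof. by apply: (@mulgI _ (f 1)); rewrite -gmulfM !mulg1. Qed.

Lemma mulfV (G H : groupType) (f : {multiplicative G -> H}) x :
  f x^-1 = (f x)^-1.
Proof. by apply: (@mulgI _ (f x)); rewrite -gmulfM !mulgV mulf1. Qed.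

Lemma card_fin (T : finType) : [set: T] #= `I_#|T|.
Proof.
rewrite (card_eqr card_II) card_eq_sym.
have c : (@enum_rank T : T -> _) @` [set: T] #= [set: T].
  by apply: inj_card_eq => x y _ _; apply: enum_rank_inj.
rewrite -(card_eqr c).
suff -> : (@enum_rank T : T -> _) @` [set: T] = setT by apply: card_eqxx.
by apply/seteqP; split=> // i _; exists (enum_val i); rewrite ?enum_valK.
Qed.


Lemma card_fin_bij (T : Type) n :
  [set: T] #= `I_n -> exists f : T -> 'I_n, bijective f.
Proof.
rewrite (card_eqr card_II) => /card_bijP[g [h gK hK]].
exists (fun x => val (g (to_setT x))), (fun i => val (h (to_setT i))) => x.
  by rewrite (_ : to_setT _ = g (to_setT x)) ?gK//; apply/val_inj.
by rewrite (_ : to_setT _ = h (to_setT x)) ?hK//; apply/val_inj.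
Qed.

Lemma card_bij_fin (T : Type) (F : finType) (f : T -> F) :
  bijective f -> [set: T] #= `I_#|F|.
Proof.
case=> g fK gK; rewrite -(card_eqr (card_fin F)) card_eq_sym.
have c : f @` [set: T] #= [set: T].
  by apply: inj_card_eq => x y _ _ /(congr1 g); rewrite !fK.
rewrite -(card_eqr c).
suff -> : f @` [set: T] = setT by apply: card_eqxx.
by apply/seteqP; split=> // y _; exists (g y); rewrite ?gK.
Qed.

Lemma card_setT_prod (A B : Type) m n :
  [set: A] #= `I_m -> [set: B] #= `I_n -> [set: A * B] #= `I_(m * n).
Proof.
move=> /card_fin_bij[f [f' fK f'K]] /card_fin_bij[g [g' gK g'K]].
rewrite -[m in (m * _)%N]card_ord -[n in (_ * n)%N]card_ord -card_prod.
apply: (@card_bij_fin _ _ (fun x : A * B => (f x.1, g x.2))).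
exists (fun y => (f' y.1, g' y.2)) => -[a b] /=; first by rewrite fK gK.
by rewrite f'K g'K.
Qed.

Import fingroup.

Lemma pi_nat_embed (pi : nat_pred) (A B : groupType)
    (f : {multiplicative A -> B}) n :
  injective f -> pi.-nat n -> [set: B] #= `I_n ->
  exists2 m, pi.-nat m & [set: A] #= `I_m.
Proof.
move=> f_inj pi_n Bn.
have [s Bs] : exists s : seq B, [set: B] = [set` s].
  by apply/finite_seqP; exists n.
have mem_s x : x \in s by have : [set: B] x by []; rewrite Bs.
pose idx (x : B) := index x s.
have idxK : cancel idx (nth 1 s) by move=> x; apply: nth_index.
have enumP : Finite.axiom (undup s).
  by move=> x; rewrite count_uniq_mem ?undup_uniq// mem_undup mem_s.
pose cB := CanIsCountable idxK.
pose fB := isFinite.Build B enumP.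
pose T : finGroupType := HB.pack (B : Type) (Group.class B) cB fB.
pose im : {set T} := [set x : T | `[< exists a, f a = x :> B >]]%SET.
have gim : group_set im.
  apply/group_setP; split.
    by rewrite inE; apply/asboolP; exists 1; exact: mulf1.
  move=> x y; rewrite !inE => /asboolP[a <-] /asboolP[b <-].
  by apply/asboolP; exists (a * b); exact: gmulfM.
have dvd := cardSg (finset.subsetT (group gim)).
have nT : n = #|T|.
  by apply/card_eq_II; rewrite -(card_eqr (card_fin T)) card_eq_sym.
exists #|im|; first by apply: pnat_dvd pi_n; rewrite nT -cardsT.
have f_im a : (f a : T) \in im by rewrite inE; apply/asboolP; exists a.
pose F a : 'I_#|im| := enum_rank_in (f_im 1) (f a).
rewrite (card_eqr card_II) card_eq_sym.
have c : F @` [set: A] #= [set: A].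
  apply: inj_card_eq => x y _ _ /(congr1 enum_val).
  by rewrite !enum_rankK_in// => /f_inj.
rewrite -(card_eqr c).
suff -> : F @` [set: A] = setT by apply: card_eqxx.
apply/seteqP; split=> // i _.
have := enum_valP i; rewrite inE => /asboolP[a fa]; exists a => //.
by apply: enum_val_inj; rewrite enum_rankK_in// fa.
Qed.

End FiniteIndex.

Section QuotientMap.
Variables (G H : groupType) (f : {multiplicative G -> H}).
Variables (M : normal_subgroup G) (N : normal_subgroup H).
Hypothesis fMN : forall x, sg_set M x -> sg_set N (f x).

Lemma setM_image x : setM (f @` lcoset M x) (sg_set N) = lcoset N (f x).
Proof.
apply/seteqP; split=> [_ [_ [_ [m Mm <-] <-] [n Nn <-]]|_ [n Nn <-]].
  by exists (f m * n); [exact: sgM (fMN Mm) Nn|rewrite gmulfM mulgA].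
exists (f x); last by exists n.
by exists x => //; exists 1; [exact: sg1|rewrite mulg1].
Qed.

Fact quot_map_subproof (c : quot M) :
  setM (f @` val c) (sg_set N) \in lcosets N.
Proof.
have [x ->] := coset_surj c.
by apply/mem_set; rewrite setM_image; apply: imageT.
Qed.

(* The map [G / M -> H / N] induced by [f], which sends [x M] to
   [f (x M) N = f x N]. *)
Definition quot_map (c : quot M) : quot N := SigSub (quot_map_subproof c).

Lemma quot_mapE x : quot_map (coset M x) = coset N (f x).
Proof. exact/val_inj/setM_image. Qed.

Fact quot_mapM : {morph quot_map : c d / c * d}.
Proof.
move=> c d; have [x ->] := coset_surj c; have [y ->] := coset_surj d.
by rewrite -cosetM !quot_mapE -cosetM gmulfM.
Qed.

HB.instance Definition _ :=
  isMultiplicative.Build (quot M) (quot N) quot_map quot_mapM.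

End QuotientMap.

(* For [pi : nat_pred], the normal subgroups whose index is finite and a
   [pi]-number: all those of finite index for [pi := predT], those
   of [p]-power index for [pi := p], [p] prime. *)
Record pi_normal (pi : nat_pred) (G : groupType) := PiNormal {
  pn_ns :> normal_subgroup G;
  pn_index : exists2 n, pi.-nat n & has_index (sg_set pn_ns) n }.

HB.instance Definition _ pi G := gen_eqMixin (pi_normal pi G).

Section Preimage.
Variables (G H : groupType) (f : {multiplicative G -> H}).

Fact preim_closed (N : subgroup H) : is_subgroup [set x | sg_set N (f x)].
Proof.
split; first by apply/mem_set; rewrite /= mulf1; apply: sg1.
move=> x y /set_mem/= Nx /set_mem/= Ny; apply/mem_set => /=.
by rewrite gmulfM mulfV; apply: sgF.
Qed.

Definition preim_sg (N : subgroup H) : subgroup G := Subgroup (preim_closed N).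

Fact preim_normal (N : normal_subgroup H) x y :
  sg_set (preim_sg N) x -> sg_set (preim_sg N) (x ^ y).
Proof.
by move=> /= Nx; rewrite conjgE !gmulfM mulfV -conjgE; apply: ns_normal.
Qed.

Definition preim_ns (N : normal_subgroup H) : normal_subgroup G :=
  NormalSubgroup (@preim_normal N).

Variables (pi : nat_pred) (N : pi_normal pi H).

Fact preim_index :
  exists2 n, pi.-nat n & has_index (sg_set (preim_ns N)) n.
Proof.
have [n pi_n Nn] := pn_index N.
have fN x : sg_set (preim_ns N) x -> sg_set N (f x) by [].
have [||m pi_m Pm] := @pi_nat_embed pi _ _ (quot_map fN) n _ pi_n.
- move=> c d; have [x ->] := coset_surj c; have [y ->] := coset_surj d.
  rewrite /= !quot_mapE => /coset_eq e.
  by apply/coset_eq; rewrite /= gmulfM mulfV.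
- by rewrite (card_eql (card_setT _)).
by exists m; rewrite // /has_index -(card_eql (card_setT _)).
Qed.

Definition preim_pn : pi_normal pi G := PiNormal preim_index.

End Preimage.

Section Intersection.
Variable G : groupType.

Fact cap_closed (M N : subgroup G) : is_subgroup (sg_set M `&` sg_set N).
Proof.
split; first by apply/mem_set; split; apply: sg1.
by move=> x y /set_mem[Mx Nx] /set_mem[My Ny]; apply/mem_set; split; apply: sgF.
Qed.

Definition cap_sg M N : subgroup G := Subgroup (cap_closed M N).

Fact cap_normal (M N : normal_subgroup G) x y :
  sg_set (cap_sg M N) x -> sg_set (cap_sg M N) (x ^ y).
Proof. by move=> /= [Mx Nx]; split; apply: ns_normal. Qed.

Definition cap_ns M N : normal_subgroup G := NormalSubgroup (@cap_normal M N).

Variables (pi : nat_pred) (M N : pi_normal pi G).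

Fact cap_index : exists2 n, pi.-nat n & has_index (sg_set (cap_ns M N)) n.
Proof.
have [m pi_m Mm] := pn_index M; have [n pi_n Nn] := pn_index N.
have sM x : sg_set (cap_ns M N) x -> sg_set M (idfun x) by case.
have sN x : sg_set (cap_ns M N) x -> sg_set N (idfun x) by case.
pose g (c : quot (cap_ns M N)) := (quot_map sM c, quot_map sN c).
have gM : {morph g : c d / c * d} by move=> c d; rewrite /g !gmulfM.
pose mg := isMultiplicative.Build _ _ g gM.
pose g' : {multiplicative quot (cap_ns M N) -> quot M * quot N} := HB.pack g mg.
have [|||k pi_k Pk] := @pi_nat_embed pi _ _ g' (m * n)%N.
- move=> c d; have [x ->] := coset_surj c; have [y ->] := coset_surj d.
  rewrite /g' /= /g !quot_mapE => /pair_equal_spec[/coset_eq eM /coset_eq eN].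
  by apply/coset_eq; split.
- by rewrite pnatM pi_m.
- by apply: card_setT_prod; rewrite (card_eql (card_setT _)).
by exists k; rewrite // /has_index -(card_eql (card_setT _)).
Qed.

Definition cap_pn : pi_normal pi G := PiNormal cap_index.

Fact full_closed : is_subgroup [set: G].
Proof. by split=> [|x y _ _]; apply/mem_set. Qed.

Definition full_ns : normal_subgroup G :=
  @NormalSubgroup G (Subgroup full_closed) (fun _ _ _ => I).

Fact full_index : exists2 n, pi.-nat n & has_index (sg_set full_ns) n.
Proof.
exists 1%N => //; rewrite /has_index.
suff -> : lcosets (sg_set full_ns) = [set [set: G]] by apply: card_set1.
apply/seteqP; split=> [_ [x _ <-]|_ ->]; last exists 1 => //.
  by apply/seteqP; split=> // y _; apply/lcosetP.
by apply/seteqP; split=> // y _; apply/lcosetP.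
Qed.

Definition full_pn : pi_normal pi G := PiNormal full_index.

End Intersection.

Section Completion.
Variables (pi : nat_pred) (G : groupType).

Definition compatible :
    set (prod_topology (fun N : pi_normal pi G => quot N)) :=
  [set x | forall (M N : pi_normal pi G)
    (sMN : forall y, sg_set M y -> sg_set N (idfun y)),
    quot_map sMN (x M) = x N].

Fact compatible_closed : is_subgroup compatible.
Proof.
split.
  by apply/mem_set => M N sMN; rewrite mulf1.
move=> x y /set_mem cx /set_mem cy; apply/mem_set => M N sMN.
by rewrite [LHS]gmulfM [_ (y^-1 M)]mulfV /= cx cy.
Qed.

Definition completion : topGroupType :=
  set_type (sg_set (Subgroup compatible_closed)).

Fact completion_in_subproof x :
  (fun N : pi_normal pi G => coset N x) \in compatible.
Proof. by apply/mem_set => M N sMN; rewrite quot_mapE. Qed.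

Definition to_completion (x : G) : completion :=
  SigSub (completion_in_subproof x).

End Completion.

Section CompletionMap.
Variables (pi : nat_pred) (G H : groupType) (f : {multiplicative G -> H}).

Definition completion_map_at (x : completion pi G) (N : pi_normal pi H) :=
  @quot_map _ _ f (preim_pn f N) N (fun _ => id) (val x (preim_pn f N)).

Fact completion_map_subproof x :
  (completion_map_at x : prod_topology _) \in @compatible pi H.
Proof.
apply/mem_set => M N sMN; rewrite /completion_map_at.
have s y : sg_set (preim_pn f M) y -> sg_set (preim_pn f N) (idfun y).
  by move=> /= /sMN.
rewrite -(set_mem (valP x) _ _ s).
have [y ->] := coset_surj (val x (preim_pn f M)).
by rewrite !quot_mapE.
Qed.

Definition completion_map (x : completion pi G) : completion pi H :=
  SigSub (completion_map_subproof x).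

Lemma completion_mapE x :
  completion_map (to_completion pi x) = to_completion pi (f x).
Proof.
apply/val_inj/functional_extensionality_dep => N.
by rewrite /= /completion_map_at /= quot_mapE.
Qed.

End CompletionMap.

Definition pro_topology (pi : nat_pred) (G : groupType) : Type := G.

Section ProTopology.
Variables (pi : nat_pred) (G : groupType).
Local Notation T := (pro_topology pi G).

Definition pro_open (U : set T) : Prop := forall x, U x ->
  exists N : pi_normal pi G, lcoset (sg_set N) x `<=` U.

Fact pro_openT : pro_open setT.
Proof. by move=> x _; exists (full_pn G pi). Qed.

Fact pro_openI : setI_closed pro_open.
Proof.
move=> U V oU oV x [Ux Vx]; have [M MU] := oU x Ux; have [N NV] := oV x Vx.
exists (cap_pn M N) => _ [y [My Ny] <-].
by split; [apply: MU|apply: NV]; exists y.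
Qed.

Fact pro_open_bigU (I : Type) (U : I -> set T) :
  (forall i, pro_open (U i)) -> pro_open (\bigcup_i U i).
Proof.
move=> oU x [i _ Uix]; have [N NU] := oU i x Uix.
by exists N => y /NU Uiy; exists i.
Qed.

HB.instance Definition _ := Choice.copy T G.
HB.instance Definition _ :=
  isOpenTopological.Build T pro_openT pro_openI pro_open_bigU.

End ProTopology.

Section Amalgam.
Variables (A B C : groupType).
Variables (i : {multiplicative C -> A}) (j : {multiplicative C -> B}).

(* The words over [A] and [B] modulo the congruence generated by the group laws
   of [A] and [B] and the identifications [i c = j c]. *)
Inductive amalg_rel : seq (A + B) -> seq (A + B) -> Prop :=
| amalg_refl w : amalg_rel w w
| amalg_sym v w : amalg_rel v w -> amalg_rel w v
| amalg_trans u v w : amalg_rel u v -> amalg_rel v w -> amalg_rel u w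
| amalg_cat u u' v v' :
    amalg_rel u u' -> amalg_rel v v' -> amalg_rel (u ++ v) (u' ++ v')
| amalg_inl1 : amalg_rel [:: inl 1] [::]
| amalg_inr1 : amalg_rel [:: inr 1] [::]
| amalg_inlM x y : amalg_rel [:: inl x; inl y] [:: inl (x * y)]
| amalg_inrM x y : amalg_rel [:: inr x; inr y] [:: inr (x * y)]
| amalg_glue c : amalg_rel [:: inl (i c)] [:: inr (j c)].

Let rel v w := `[< amalg_rel v w >].

Fact amalg_equiv : equiv_class_of rel.
Proof.
split=> [w|v w|v u w].
- exact/asboolP/amalg_refl.
- by apply/asboolP/asboolP; apply: amalg_sym.
- by move=> /asboolP uv /asboolP vw; apply/asboolP/(amalg_trans uv).
Qed.

Canonical amalg_equiv_rel := EquivRelPack amalg_equiv.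

Definition amalgam : Type := {eq_quot amalg_equiv_rel}%qT.
HB.instance Definition _ := Choice.on amalgam.

Definition amalg_word (w : seq (A + B)) : amalgam :=
  \pi_({eq_quot amalg_equiv_rel})%qT w.

Lemma amalg_wordP v w : amalg_word v = amalg_word w <-> amalg_rel v w.
Proof. by split=> [/eqquotP/asboolP|vw]; [|apply/eqquotP/asboolP]. Qed.

Lemma amalg_surj (x : amalgam) : exists w, x = amalg_word w.
Proof. by exists (repr x); rewrite /amalg_word reprK. Qed.

Definition inv_letter (a : A + B) : A + B :=
  match a with inl x => inl x^-1 | inr y => inr y^-1 end.

Definition inv_word (w : seq (A + B)) := rev (map inv_letter w).

Lemma inv_wordP v w : amalg_rel v w -> amalg_rel (inv_word v) (inv_word w).
Proof.
elim=> {v w} [w|v w _|u v w _ uv _ vw|u u' v v' _ uu' _ vv'|||x y|x y|c].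
- exact: amalg_refl.
- exact: amalg_sym.
- exact: amalg_trans uv vw.
- by rewrite /inv_word !map_cat !rev_cat; apply: amalg_cat.
- by rewrite /inv_word /= /rev /= invg1; apply: amalg_inl1.
- by rewrite /inv_word /= /rev /= invg1; apply: amalg_inr1.
- by rewrite /inv_word /= /rev /= invgM; apply: amalg_inlM.
- by rewrite /inv_word /= /rev /= invgM; apply: amalg_inrM.
- by rewrite /inv_word /= /rev /= -!mulfV; apply: amalg_glue.
Qed.

Lemma inv_wordVg w : amalg_rel (inv_word w ++ w) [::].
Proof.
elim: w => [|a w IHw]; first exact: amalg_refl.
rewrite /inv_word /= rev_cons cat_rcons -[_ :: _ :: w]/([:: _; _] ++ w).
apply: amalg_trans IHw; apply: amalg_cat; first exact: amalg_refl.
apply: (@amalg_trans _ ([::] ++ w)); last exact: amalg_refl.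
apply: amalg_cat; last exact: amalg_refl.
case: a => x /=.
  by apply: amalg_trans (amalg_inlM _ _) _; rewrite mulVg; apply: amalg_inl1.
by apply: amalg_trans (amalg_inrM _ _) _; rewrite mulVg; apply: amalg_inr1.
Qed.

Lemma inv_wordK : involutive inv_word.
Proof.
move=> w; rewrite /inv_word map_rev revK -map_comp.
by rewrite -[RHS]map_id; apply: eq_map => -[] x /=; rewrite invgK.
Qed.

Definition amalg_mul (x y : amalgam) : amalgam := amalg_word (repr x ++ repr y).
Definition amalg_inv (x : amalgam) : amalgam := amalg_word (inv_word (repr x)).

Lemma amalg_repr w : amalg_rel (repr (amalg_word w)) w.
Proof. by apply/amalg_wordP; rewrite /amalg_word reprK. Qed.

Lemma amalg_mulE v w :
  amalg_mul (amalg_word v) (amalg_word w) = amalg_word (v ++ w).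
Proof. by apply/amalg_wordP/amalg_cat; apply: amalg_repr. Qed.

Lemma amalg_invE w : amalg_inv (amalg_word w) = amalg_word (inv_word w).
Proof. exact/amalg_wordP/inv_wordP/amalg_repr. Qed.

Fact amalg_mulA : associative amalg_mul.
Proof.
move=> x y z; have [u ->] := amalg_surj x; have [v ->] := amalg_surj y.
by have [w ->] := amalg_surj z; rewrite !amalg_mulE catA.
Qed.

Fact amalg_mul1g : left_id (amalg_word [::]) amalg_mul.
Proof. by move=> x; have [w ->] := amalg_surj x; rewrite amalg_mulE. Qed.

Fact amalg_mulg1 : right_id (amalg_word [::]) amalg_mul.
Proof. by move=> x; have [w ->] := amalg_surj x; rewrite amalg_mulE cats0. Qed.

Fact amalg_mulVg : left_inverse (amalg_word [::]) amalg_inv amalg_mul.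
Proof.
move=> x; have [w ->] := amalg_surj x; rewrite amalg_invE amalg_mulE.
exact/amalg_wordP/inv_wordVg.
Qed.

Fact amalg_mulgV : right_inverse (amalg_word [::]) amalg_inv amalg_mul.
Proof.
move=> x; have [w ->] := amalg_surj x; rewrite amalg_invE amalg_mulE.
by apply/amalg_wordP; rewrite -{1}[w]inv_wordK; apply: inv_wordVg.
Qed.

HB.instance Definition _ := isGroup.Build amalgam
  amalg_mulA amalg_mul1g amalg_mulg1 amalg_mulVg amalg_mulgV.

Definition amalg_inl (x : A) : amalgam := amalg_word [:: inl x].
Definition amalg_inr (y : B) : amalgam := amalg_word [:: inr y].

Lemma amalg_inl_inr c : amalg_inl (i c) = amalg_inr (j c).
Proof. exact/amalg_wordP/amalg_glue. Qed.

Lemma amalg_universal (T : groupType)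
    (f : {multiplicative A -> T}) (g : {multiplicative B -> T}) :
  (forall c, f (i c) = g (j c)) ->
  exists! h : amalgam -> T, [/\ {morph h : x y / x * y},
    forall x, h (amalg_inl x) = f x & forall y, h (amalg_inr y) = g y].
Proof.
move=> fg; pose l (a : A + B) := match a with inl x => f x | inr y => g y end.
pose hw w := \big[*%g/1]_(a <- w) l a.
have hwP v w : amalg_rel v w -> hw v = hw w.
  elim=> {v w} //= [u v w _ -> _ ->|u u' v v' _ uu' _ vv'|||x y|x y|c] //;
    rewrite /hw ?big_cat ?big_cons ?big_nil /= ?mulg1 ?mulf1 ?gmulfM //.
  by congr (_ * _).
have hE w : hw (repr (amalg_word w)) = hw w by apply/hwP/amalg_repr.
exists (fun x => hw (repr x)); split.
  split=> [x y|x|y].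
  - by rewrite [LHS]hE /hw big_cat.
  - by rewrite hE /hw big_cons big_nil mulg1.
  - by rewrite hE /hw big_cons big_nil mulg1.
move=> h [hM hl hr]; apply/funext => x; have [w ->] := amalg_surj x.
rewrite hE; elim: w => [|a w IHw].
  rewrite /hw big_nil; apply: (@mulgI _ (h (amalg_word [::]))).
  by rewrite -hM mulg1 mulg1.
rewrite /hw big_cons -/(hw w) IHw -[a :: w]cat1s -amalg_mulE hM.
by congr (_ * _); case: a => y /=; rewrite -?hl -?hr.
Qed.

End Amalgam.

Definition amalgam_double (H : groupType) (K : subgroup H) : groupType :=
  amalgam (@sg_incl H K) (@sg_incl H K).

Definition finitely_generated (G : groupType) : Prop :=
  exists2 A : set G, finite_set A & gen A = setT.

Definition linear_group (G : groupType) : Prop :=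
  exists (F : fieldType) (n : nat) (r : G -> 'M[F]_n),
    [/\ forall x, r x \in unitmx,
        forall x y, r (x * y) = (r x *m r y)%R & injective r].

Definition boundedly_generated (G : groupType) : Prop :=
  exists gs : seq G, \big[@setM G/[set 1]]_(g <- gs) gen [set g] = setT.

Definition top_boundedly_generated (G : topGroupType) : Prop :=
  exists gs : seq G,
    \big[@setM G/[set 1]]_(g <- gs) closure (gen [set g]) = setT.

Definition residually (pi : nat_pred) (G : groupType) : Prop :=
  injective (@to_completion pi G).

Definition top_isomorphic (G H : topGroupType) : Prop :=
  exists f : G -> H, exists g : H -> G,
    [/\ {morph f : x y / x * y}, cancel f g, cancel g f,
        continuous f & continuous g].

Definition profinite_completion := completion predT.
Definition residually_finite := residually predT.

(* Main.v *)
From HB Require Import structures.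
Require Import Defs.
From mathcomp Require Import all_boot all_order all_algebra.
From mathcomp Require fingroup cyclic perm.
From mathcomp Require Import qpoly algC zify ring.
From mathcomp Require Import all_classical topology.

(** Let q > 4 be a prime different from p, f = x^q + p q x - 1, A = Z[x]/(f)
    and u the class of x, a unit since u (u^(q-1) + p q) = 1. Put
    H = A ><| Z, where Z acts on A by multiplication by u, and K = A ><| q Z,
    a normal subgroup of index q.

    The polynomial f is x^q - 1 modulo p, with the simple root 1, and
    f(x + 1) is an Eisenstein polynomial at q; since the latter is how
    irreducibility is proved, the ring is written with x + 1 in place of x
    ([modulus]). Irreducibility says that every nonzero element of A divides
    a nonzero integer ([qpoly_divides_int]). Hence A embeds into the algebraic
    numbers, which makes H linear, and A is separated by the maps A -> Z/p^k
    sending x to a root of f modulo p^k that is 1 modulo p, which exists by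
    Hensel's lemma ([root_mod_prime_power]); these maps extend to maps from H
    onto finite p-groups, so H is residually p. Bounded generation is clear,
    H being abelian by cyclic with A finitely generated as a group.

    A quotient of H of order n, a power of p, kills u^n - 1, because the
    generator of Z has order dividing n there. As q is prime to n, this makes
    K dense; and u^n is not 1 modulo p A, since u^q is and u is not. But A/pA
    is a quotient of K, on which u^q acts trivially. So the pro-p completion
    of K is strictly larger than the closure of K in that of H
    ([rot_completion_not_inj]).

    In a finite p-quotient of the double Gamma = H *_K H the two copies of H
    coincide, because they do on the dense subgroup K. Hence folding induces
    an isomorphism of the pro-p completions ([double_completion_iso]), and
    Gamma is not residually p.

    The other finite quotients of Gamma used here factor through Gamma/K =
    Z/q * Z/q, that is, they are given by two elements of order dividing q in
    a finite group. Together with folding they show that Gamma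
    is residually finite: a reduced word in the free product is detected by two
    explicit permutations ([alternating_moves]). If the profinite completion
    were a product of d procyclic subgroups, then a finite quotient of exponent
    e would have order at most e^d ([bounded_completion_card]); but in iterated
    wreath products there are pairs of elements of order q generating groups
    whose order is exponential in the exponent ([finite_groups_not_bounded]).
    This is where q > 4 is used. *)

Set Implicit Arguments.
Unset Strict Implicit.
Unset Printing Implicit Defensive.

(** * The coefficient ring *)

Section QuotientEval.
Import GRing.Theory Num.Theory.
Local Open Scope ring_scope.
Variables (g : {poly int}) (g_gt1 : (1 < size g)%N) (g_mon : g \is monic).
Local Notation A := {poly %/ g}.

Lemma mk_monicE : mk_monic g = g.
Proof. by rewrite /mk_monic g_gt1 g_mon. Qed.

Lemma in_qpolyK (a : A) : in_qpoly g a = a.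
Proof. by apply/val_inj/in_qpoly_small/size_mk_monic. Qed.

Lemma in_qpoly_int (c : int) : in_qpoly g c%:P = c%:~R.
Proof. by rewrite -[c in LHS]intz rmorph_int rmorph_int. Qed.

Lemma in_qpoly_modulus : in_qpoly g g = 0.
Proof.
by apply: val_inj; rewrite /= mk_monicE Pdiv.RingMonic.rmodpp.
Qed.

Lemma qpoly_eval (R : comNzRingType) (t : R) : (map_poly intr g).[t] = 0 ->
  exists f : {rmorphism A -> R},
    forall P, f (in_qpoly g P) = (map_poly intr P).[t].
Proof.
move=> gt0; pose f (a : A) := (map_poly intr (a : {poly int})).[t].
have fE P : f (in_qpoly g P) = (map_poly intr P).[t].
  rewrite [in RHS](Pdiv.RingMonic.rdivp_eq g_mon P) rmorphD rmorphM /=.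
  by rewrite !hornerE gt0 mulr0 add0r /f /= mk_monicE.
have fB : zmod_morphism f.
  by move=> a b; rewrite /f -hornerN -hornerD -rmorphB.
have fM : monoid_morphism f.
  split=> [|a b]; first by rewrite -in_qpoly1 fE rmorph1 hornerE.
  by rewrite -(in_qpolyK a) -(in_qpolyK b) -in_qpolyM !fE rmorphM hornerM.
pose m1 := GRing.isZmodMorphism.Build A R f fB.
pose m2 := GRing.isMonoidMorphism.Build A R f fM.
by exists (HB.pack_for {rmorphism A -> R} f m1 m2).
Qed.

(** The integer is the resultant of [g] and of the representative of [a],
    which is nonzero because [g] is irreducible and has the larger degree. *)
Lemma qpoly_divides_int (a : A) : irreducible_poly g -> a != 0 ->
  exists (b : A) (c : int), c != 0 /\ b * a = c%:~R.
Proof.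
move=> g_irr a0; pose P : {poly int} := a.
have P0 : P != 0 by apply: contra a0 => /eqP P0; apply/eqP/val_inj.
have szP : (size P < size g)%N by rewrite -mk_monicE; apply: size_mk_monic.
have [Pc|Pn] := leqP (size P) 1.
  have Pc0 := size1_polyC Pc; exists 1, P`_0; split.
    by apply: contra P0 => /eqP P00; rewrite Pc0 P00 polyC0.
  by rewrite mul1r -in_qpoly_int -Pc0 in_qpolyK.
have [[U V] /= _ UV] := resultant_in_ideal g_gt1 Pn.
exists (in_qpoly g V), (resultant g P); split.
  rewrite resultant_eq0; apply/negP => gcd_gt1.
  have /g_irr.2 gd : size (gcdp g P) != 1 by rewrite gtn_eqF.
  have /eqp_dvdl gP := gd (dvdp_gcdl _ _).
  by have := dvdp_gcdr g P; rewrite gP => /(dvdp_leq P0); rewrite leqNgt szP.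
rewrite -in_qpoly_int UV raddfD /= !in_qpolyM in_qpoly_modulus mulr0 add0r.
by rewrite in_qpolyK.
Qed.

End QuotientEval.

Section Hensel.
Import GRing.Theory Num.Theory.
Local Open Scope ring_scope.

Lemma binomial_taylor2 (R : comNzRingType) (x h : R) n :
  exists c, (x + h) ^+ n = x ^+ n + n%:R * x ^+ n.-1 * h + c * h ^+ 2.
Proof.
elim: n => [|n [c IH]]; first by exists 0; rewrite !expr0 mul0r; ring.
exists (n%:R * x ^+ n.-1 + c * (x + h)); rewrite exprS IH /=.
case: n {IH} => [|n]; first by rewrite !expr0 /= !mul0r; ring.
rewrite /= -!natr1 [x ^+ n.+1]exprS [x ^+ n.+2]exprS [x ^+ n.+1]exprS; ring.
Qed.

Variables (p q : nat).
Hypotheses (p_pr : prime p) (cpq : coprime p q).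

(** Hensel's lemma for [(s + 1)^q - 1 + p q (s + 1)] at the root [s = 0]
    modulo [p], which is simple because the derivative is [q] modulo [p]. *)
Lemma root_mod_prime_power k : exists s : int, (p %| s)%Z /\
  ((p ^ k.+1)%N %| (s + 1) ^+ q - 1 + (p * q)%:R * (s + 1))%Z.
Proof.
elim: k => [|k [s [ps /dvdzP[r sr]]]].
  exists 0; split; first exact: dvdz0.
  by rewrite add0r expr1n subrr add0r mulr1 expn1 natz PoszM dvdz_mulr.
have [x [y xy]] := Bezoutz q p.
have {}xy : x * q%:Z + y * p%:Z = 1.
  by rewrite xy /gcdz /= gcdnC (eqP cpq).
have [w sw] : exists w, (s + 1) ^+ q.-1 = w * p%:Z + 1.
  have /dvdzP[w e] : (p %| (s + 1) ^+ q.-1 - 1)%Z.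
    by rewrite subrX1 addrK dvdz_mulr.
  by exists w; rewrite -e subrK.
pose P : int := (p ^ k.+1)%N%:Z.
(* The Newton step: [x] is an inverse of the derivative modulo [p]. *)
have [c tc] := binomial_taylor2 (s + 1) (P * (- r * x)) q.
exists (s + P * (- r * x)); split.
  by rewrite rpredD// /P expnS PoszM -!mulrA dvdz_mulr.
have PE : (p ^ k.+2)%N%:Z = p%:Z * P by rewrite expnS PoszM.
pose e : int := (p ^ k)%N%:Z; have Pe : P = p%:Z * e by rewrite /P expnS PoszM.
rewrite [s + _ + 1]addrAC tc sw PE natz PoszM; apply/dvdzP.
exists (r * y - r * x * (q%:Z * w + q%:Z) + c * e * (r * x) ^+ 2).
have -> : (s + 1) ^+ q = r * P + 1 - p%:Z * q%:Z * (s + 1).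
  by rewrite -sr natz PoszM; ring.
rewrite natz Pe; move: (p%:Z) (q%:Z) xy => P' Q' xy.
apply/eqP; rewrite -subr_eq0; apply/eqP.
transitivity (r * (P' * e) * (1 - (x * Q' + y * P'))); first by ring.
by rewrite xy subrr mulr0.
Qed.

(** If [y] is 1 modulo [p^(k+1)], then [1 + y + ... + y^(p-1)] is divisible
    by [p], so that [y^p] is 1 modulo [p^(k+2)]. *)
Lemma expr_prime_power_mod (s : int) k : (p %| s)%Z ->
  ((p ^ k)%N %| (s + 1) ^+ (p ^ k) - 1)%Z.
Proof.
move=> ps.
suff : ((p ^ k.+1)%N %| (s + 1) ^+ (p ^ k) - 1)%Z.
  by apply: dvdz_trans; rewrite expnS PoszM dvdz_mull.
elim: k => [|k IH]; first by rewrite expn0 expn1 expr1 addrK.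
rewrite expnSr exprM; set y := _ ^+ (p ^ k) in IH *.
rewrite subrX1 mulrC expnS PoszM; apply: dvdz_mul => //.
have py : (y == 1 %[mod p])%Z.
  by rewrite eqz_mod_dvd; apply: dvdz_trans IH; rewrite expnS PoszM dvdz_mulr.
have : (\sum_(i < p) y ^+ i == \sum_(i < p) 1 %[mod p])%Z.
  rewrite eqz_mod_dvd -sumrB; apply: rpred_sum => i _.
  rewrite -eqz_mod_dvd -modzXm (eqP py) modzXm expr1n; exact/eqP.
rewrite sumr_const card_ord => /eqP e; apply/dvdz_mod0P; rewrite e.
by rewrite -mulr_natr mul1r natz modzz.
Qed.

End Hensel.

Section Modulus.
Import GRing.Theory Num.Theory.
Local Open Scope ring_scope.
Variables (p q : nat).
Hypotheses (p_pr : prime p) (q_pr : prime q) (cpq : coprime p q).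

(** The polynomial [x^q + p q x - 1] at [x = 'X + 1]: shifted like this it is
    Eisenstein at [q], with constant coefficient [p q]. *)
Definition modulus : {poly int} :=
  ('X + 1) ^+ q - 1 + ((p * q)%:R)%:P * ('X + 1).
Local Notation g := modulus.

Lemma modulus_size_monic : size g = q.+1 /\ g \is monic.
Proof.
have q1 := prime_gt1 q_pr.
have s1 : size (('X + 1 : {poly int}) ^+ q) = q.+1.
  by rewrite -[1]polyC1 -[1]opprK polyCN size_exp_XsubC.
have m1 : ('X + 1 : {poly int}) ^+ q \is monic.
  by rewrite monic_exp// -[1]polyC1 -[1]opprK polyCN monicXsubC.
have s2 : (size (- 1 + ((p * q)%:R)%:P * ('X + 1) : {poly int})%R < q.+1)%N.
  apply: leq_ltn_trans (size_polyD _ _) _.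
  rewrite gtn_max size_polyN size_poly1.
  rewrite ltnS (ltnW q1) /=; apply: leq_ltn_trans (size_polyMleq _ _) _.
  rewrite -polyC1 size_XaddC addn2 /= ltnS.
  by apply: leq_ltn_trans (size_polyC_leq1 _) _.
rewrite /g -addrA size_polyDl s1// monicE lead_coefDl ?s1//.
Qed.

Lemma modulus_coef i : (i < q)%N -> g`_i =
  'C(q, i)%:R - (i == 0)%N%:R + (p * q)%:R * ((i == 1)%N%:R + (i == 0)%N%:R).
Proof.
move=> iq; have -> : g = \poly_(j < q.+1) 'C(q, j)%:R - 1
    + ((p * q)%:R)%:P * ('X + 1).
  rewrite /g; congr (_ - _ + _); rewrite addrC exprDn poly_def.
  by apply: eq_bigr => j _; rewrite expr1n mul1r scaler_nat.
by rewrite !coefE ltnS ltnW.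
Qed.

Lemma modulus_irreducible : irreducible_poly g.
Proof.
have [sg mg] := modulus_size_monic; have q0 := prime_gt0 q_pr.
apply: (eisenstein_crit q_pr); rewrite ?sg.
- by rewrite eqSS -lt0n.
- by rewrite (monicP mg) dvdz1 absz_nat gtn_eqF// prime_gt1.
- rewrite modulus_coef// bin0 subrr !add0r mulr1 natz dvdzE !absz_nat.
  rewrite -[(q ^+ 2)%R]/(q * q)%N.
  by rewrite dvdn_pmul2r// -prime_coprime// coprime_sym.
- move=> i iq; rewrite modulus_coef// rpredD//; last first.
    by rewrite natz PoszM dvdz_mulr ?dvdz_mull.
  case: i iq => [|i] iq; first by rewrite bin0 subrr dvdz0.
  by rewrite subr0 natz dvdzE !absz_nat prime_dvd_bin.
Qed.

Local Notation A := {poly %/ g}.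

Let g_gt1 : (1 < size g)%N.
Proof. by have [-> _] := modulus_size_monic; rewrite ltnS prime_gt0. Qed.

Let g_mon : g \is monic. Proof. by case: modulus_size_monic. Qed.

Let g_irr := modulus_irreducible.

(** The root of [x^q + p q x - 1] in [A]. *)
Definition ring_u : A := in_qpoly g ('X + 1).
Definition ring_v : A := ring_u ^+ q.-1 + (p * q)%:R.

Lemma ring_uX : ring_u ^+ q = 1 - (p * q)%:R * ring_u.
Proof.
have eX : in_qpoly g (('X + 1) ^+ q) = ring_u ^+ q by apply: rmorphXn.
have ec : in_qpoly g ((p * q)%:R)%:P = (p * q)%:R.
  by rewrite in_qpoly_int rmorph_nat.
have e : ring_u ^+ q - 1 + (p * q)%:R * ring_u = 0.
  by rewrite -eX -ec -(in_qpoly1 g) -(raddfB (in_qpoly g)) -in_qpolyM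
    -in_qpolyD; apply: in_qpoly_modulus.
by apply/eqP; rewrite -subr_eq0 -e; apply/eqP; ring.
Qed.

Lemma ring_uv : ring_u * ring_v = 1.
Proof.
rewrite mulrDr -exprS prednK ?prime_gt0// ring_uX [ring_u * _]mulrC.
by rewrite subrK.
Qed.

Lemma in_qpoly_small_val (P : {poly int}) : (size P <= q)%N ->
  in_qpoly g P = P :> {poly int}.
Proof.
have [sg _] := modulus_size_monic.
by move=> sP; apply: in_qpoly_small; rewrite mk_monicE// sg ltnS.
Qed.

Lemma size_ring (a : A) : (size (a : {poly int}) <= q)%N.
Proof.
have [sg _] := modulus_size_monic.
have e : (size (mk_monic g)).-1 = q by rewrite mk_monicE// sg.
exact: leq_trans (size_npoly a) (eq_leq e).
Qed.

Lemma ring_span (a : A) :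
  exists c : 'I_q -> int, a = \sum_(i < q) in_qpoly g 'X^i *~ c i.
Proof.
exists (fun i => (a : {poly int})`_i).
have e : (a : {poly int}) = \sum_(i < q) 'X^i *~ (a : {poly int})`_i.
  apply/polyP => j; rewrite coef_sum.
  have [jq|qj] := ltnP j q.
    rewrite (bigD1 (Ordinal jq))//= big1 ?addr0 => [|i ij].
      by rewrite -scaler_int coefZ coefXn eqxx mulr1 intz.
    rewrite -scaler_int coefZ coefXn [j == _]eq_sym.
    by move: ij; rewrite -val_eqE /= => /negPf->; rewrite mulr0.
  rewrite nth_default ?(leq_trans (size_ring a))// big1// => i _.
  by rewrite -scaler_int coefZ coefXn gtn_eqF ?mulr0// (leq_trans _ qj).
rewrite -[LHS]in_qpolyK {1}e raddf_sum.
by apply: eq_bigr => i _; rewrite raddfMz.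
Qed.

Lemma ring_embeds :
  exists (F : numFieldType) (f : {rmorphism A -> F}), injective f.
Proof.
have [t gt0] : exists t : algC, (map_poly intr g).[t] = 0.
  have /closed_rootP[t /rootP] : size (map_poly (intr : int -> algC) g) != 1%N.
    by rewrite size_map_poly_id0 ?gtn_eqF// (monicP g_mon) rmorph1 oner_eq0.
  by exists t.
have [f fE] := qpoly_eval g_gt1 g_mon gt0; exists algC, f.
apply: raddf_inj => a fa; apply/eqP/negPn/negP => a0.
have [b [c [c0 ba]]] := qpoly_divides_int g_gt1 g_mon g_irr a0.
have /eqP := rmorphM f b a; rewrite ba fa mulr0 rmorph_int intr_eq0.
by rewrite (negPf c0).
Qed.

(** Send [ring_u] to a root that is 1 modulo [p] in the integers modulo
    [p^k], for a [k] so large that an integer divisible by [a] is not killed. *)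
Lemma ring_residual (a : A) : a != 0 ->
  exists (R : finComNzRingType) (f : {rmorphism A -> R}),
  [/\ p.-nat #|R|, forall c, exists a, f a = c, f ring_u ^+ #|R| = 1
    & f a != 0].
Proof.
move=> a0; have [b [c [c0 ba]]] := qpoly_divides_int g_gt1 g_mon g_irr a0.
pose k := `|c|%N.
have pk1 : (1 < p ^ k.+1)%N by rewrite -(expn0 p) ltn_exp2l ?prime_gt1.
have [s [ps gs]] := root_mod_prime_power cpq k.
pose R := 'Z_(p ^ k.+1); pose t : R := s%:~R.
have Rn : (p ^ k.+1)%:R = 0 :> R by apply: pchar_Zp.
have R0 (z : int) : ((p ^ k.+1)%N %| z)%Z -> z%:~R = 0 :> R.
  by move=> /dvdzP[w ->]; rewrite intrM -[X in _ * X]pmulrn Rn mulr0.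
have [|f fE] := @qpoly_eval g g_gt1 g_mon R t.
  rewrite horner_map /=; apply: R0; move: gs.
  by rewrite /g !hornerE.
have fu : f ring_u = (s + 1)%:~R.
  by rewrite fE rmorphD rmorph1 /= map_polyX !hornerE rmorphD.
have cR : #|R| = (p ^ k.+1)%N by rewrite card_ord Zp_cast.
exists R, f; split.
- by rewrite cR pnatX pnat_id.
- by move=> x; exists (x : nat)%:R; rewrite rmorph_nat natr_Zp.
- have := R0 _ (expr_prime_power_mod k.+1 ps).
  rewrite rmorphB rmorph1 rmorphXn /=.
  by rewrite cR fu => /eqP; rewrite subr_eq0 => /eqP.
- apply/eqP => fa; have := rmorphM f b a; rewrite ba fa mulr0 rmorph_int.
  suff cn : (`|c|%N)%:R != 0 :> R.
    move/eqP: cn => cn e; apply: cn.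
    case: (c) e => n /=; rewrite ?NegzE ?rmorphN /= => /eqP.
      by move=> /eqP.
    by rewrite oppr_eq0 => /eqP.
  apply/eqP => /(congr1 val) /=; rewrite val_Zp_nat//= modn_small; last first.
    by rewrite (ltn_trans (ltn_expl k (prime_gt1 p_pr)))// ltn_exp2l ?prime_gt1.
  by move/eqP; rewrite absz_eq0 (negPf c0).
Qed.

(** The quotient map [A -> A/pA], in coordinates. *)
Definition coef_mod (a : A) : 'rV['F_p]_q := \row_i ((a : {poly int})`_i)%:~R.

Fact coef_mod_is_zmod_morphism : zmod_morphism coef_mod.
Proof. by move=> a b; apply/rowP => i; rewrite !mxE -rmorphB /= coefB. Qed.

HB.instance Definition _ :=
  GRing.isZmodMorphism.Build A 'rV['F_p]_q coef_mod coef_mod_is_zmod_morphism.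

Lemma coef_mod_surj c : exists a, coef_mod a = c.
Proof.
pose P : {poly int} :=
  \poly_(i < q) (if insub i is Some j then (c 0 j : nat)%:Z else 0).
exists (in_qpoly g P); apply/rowP => i.
rewrite mxE in_qpoly_small_val ?size_poly// coef_poly ltn_ord valK.
by rewrite -pmulrn natr_Zp.
Qed.

Lemma coef_mod_eq0 a : coef_mod a = 0 <-> exists b, a = p%:R * b.
Proof.
split=> [/rowP a0|[b ->]]; last first.
  rewrite mulr_natl raddfMn; apply/rowP => i.
  by rewrite mulmxnE -mulr_natr pchar_Fp_0// mulr0 mxE.
pose P : {poly int} := \poly_(i < q) ((a : {poly int})`_i %/ p)%Z.
exists (in_qpoly g P); rewrite -[LHS]in_qpolyK.
have -> : (a : {poly int}) = p%:R * P.
  apply/polyP => j; rewrite mulr_natl coefMn coef_poly.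
  have [jq|qj] := ltnP j q; last first.
    by rewrite mul0rn nth_default// (leq_trans (size_ring a)).
  rewrite -mulr_natr natz divzK//.
  rewrite (dvdz_pcharf (pchar_Fp p_pr)).
  by have := a0 (Ordinal jq); rewrite !mxE => ->.
by rewrite in_qpolyM rmorph_nat.
Qed.

Lemma coef_mod_fix a : coef_mod (a * ring_u ^+ q) = coef_mod a.
Proof.
apply/eqP; rewrite -subr_eq0 -raddfB; apply/eqP/coef_mod_eq0.
exists (- (q%:R * a * ring_u)); rewrite ring_uX natrM; ring.
Qed.

(** Modulo [p] the order of [ring_u] divides [q], which is prime to [n]; so
    [ring_u ^+ n = 1] would give [ring_u = 1], and 1 and ['X + 1] differ
    modulo [p]. *)
Lemma coef_mod_move n : p.-nat n -> coef_mod (ring_u ^+ n) != coef_mod 1.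
Proof.
move=> pn; apply/eqP => un1; have q1 := prime_gt1 q_pr.
have fix_n a : coef_mod (a * ring_u ^+ n) = coef_mod a.
  apply/eqP; rewrite -subr_eq0 -raddfB /= -{2}[a]mulr1 -mulrBr.
  have /coef_mod_eq0[b ->] : coef_mod (ring_u ^+ n - 1) = 0.
    by rewrite raddfB /= un1 subrr.
  by apply/eqP/coef_mod_eq0; exists (a * b); ring.
have fix_exp r k a : (forall b, coef_mod (b * ring_u ^+ r) = coef_mod b) ->
    coef_mod (a * ring_u ^+ (r * k)) = coef_mod a.
  move=> fr; elim: k a => [|k IH] a; first by rewrite muln0 expr0 mulr1.
  by rewrite mulnS exprD mulrA IH fr.
have cqn : coprime q n.
  by have [k ->] := p_natP pn; rewrite coprimeXr// coprime_sym.
have [kq kn kE _] := egcdnP n (prime_gt0 q_pr).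
have : coef_mod ring_u = coef_mod 1.
  rewrite -(fix_exp n kn ring_u fix_n) -exprS.
  have -> : ((n * kn).+1 = q * kq)%N.
    by rewrite mulnC [RHS]mulnC kE (eqP cqn) addn1.
  by rewrite -[X in coef_mod X]mul1r fix_exp//; apply: coef_mod_fix.
move=> /rowP/(_ (Ordinal q1)); rewrite !mxE /ring_u.
rewrite in_qpoly_small_val; last first.
  by rewrite -polyC1 size_XaddC.
rewrite coefD coefX !coef1 /= addr0 => /eqP.
by rewrite mulr1z mulr0z oner_eq0.
Qed.

End Modulus.

(** * Pairs of elements of finite order that generate large groups *)

Section Wreath.
Import fingroup cyclic.
Local Open Scope group_scope.
Variables (I B : finGroupType).

(** The regular wreath product of [B] by [I]. *)
Definition wreath : Type := ({ffun I -> B} * I)%type.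
HB.instance Definition _ := Finite.on wreath.
Implicit Types (v w : wreath) (f g : {ffun I -> B}).

Definition wreath_mul v w : wreath :=
  ([ffun k => v.1 k * w.1 (v.2^-1 * k)], v.2 * w.2).
Definition wreath_one : wreath := ([ffun=> 1], 1).
Definition wreath_inv w : wreath := ([ffun k => (w.1 (w.2 * k))^-1], w.2^-1).

Fact wreath_mulA : associative wreath_mul.
Proof.
move=> u v w; congr pair; last exact: mulgA.
by apply/ffunP => k; rewrite !ffunE /= mulgA invMg mulgA.
Qed.

Fact wreath_mul1 : left_id wreath_one wreath_mul.
Proof.
case=> f i; congr pair; last exact: mul1g.
by apply/ffunP => k; rewrite !ffunE /= mul1g invg1 mul1g.
Qed.

Fact wreath_mulV : left_inverse wreath_one wreath_inv wreath_mul.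
Proof.
case=> f i; congr pair; last exact: mulVg.
by apply/ffunP => k; rewrite !ffunE /= invgK mulVg.
Qed.

HB.instance Definition _ :=
  Finite_isGroup.Build wreath wreath_mulA wreath_mul1 wreath_mulV.

Definition base f : wreath := (f, 1).
Definition shift (i : I) : wreath := ([ffun=> 1], i).

Lemma wreathM v w :
  v * w = ([ffun k => v.1 k * w.1 (v.2^-1 * k)], v.2 * w.2) :> wreath.
Proof. by []. Qed.

Lemma wreathV w : w^-1 = ([ffun k => (w.1 (w.2 * k))^-1], w.2^-1) :> wreath.
Proof. by []. Qed.

Lemma baseM f g : base f * base g = base [ffun k => f k * g k].
Proof.
rewrite wreathM /base /= mulg1; congr pair.
by apply/ffunP => k; rewrite !ffunE invg1 mul1g.
Qed.

Lemma baseV f : (base f)^-1 = base [ffun k => (f k)^-1].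
Proof.
rewrite wreathV /base /= invg1; congr pair.
by apply/ffunP => k; rewrite !ffunE mul1g.
Qed.

Lemma baseX f n : base f ^+ n = base [ffun k => f k ^+ n].
Proof.
elim: n => [|n IH].
  by congr pair; apply/ffunP => k; rewrite !ffunE expg0.
rewrite expgS IH baseM; congr base; apply/ffunP => k.
by rewrite !ffunE expgS.
Qed.

Lemma baseJ f g : base f ^ base g = base [ffun k => f k ^ g k].
Proof.
rewrite conjgE baseV !baseM; congr base; apply/ffunP => k.
by rewrite !ffunE conjgE.
Qed.

Lemma baseR f g : [~ base f, base g] = base [ffun k => [~ f k, g k]].
Proof.
rewrite commgEl baseJ baseV !baseM; congr base; apply/ffunP => k.
by rewrite !ffunE commgEl.
Qed.

Lemma shiftV i : (shift i)^-1 = shift i^-1.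
Proof.
rewrite wreathV; congr pair.
by apply/ffunP => k; rewrite !ffunE invg1.
Qed.

Lemma shiftX i n : shift i ^+ n = shift (i ^+ n).
Proof.
elim: n => [|n IH]; first by [].
rewrite !expgS IH wreathM; congr pair.
by apply/ffunP => k; rewrite !ffunE mulg1.
Qed.

Lemma base_shift f i : base f ^ shift i = base [ffun k => f (i * k)].
Proof.
rewrite conjgE shiftV !wreathM /base /= mul1g mulVg; congr pair.
by apply/ffunP => k; rewrite !ffunE mul1g mulg1 invgK.
Qed.

Lemma wreath_exponent e : (forall b : B, b ^+ e = 1) ->
  forall w, w ^+ (#|I| * e) = 1.
Proof.
move=> Be w; rewrite expgM.
have w2 n : (w ^+ n).2 = w.2 ^+ n.
  by elim: n => [|n IH] //; rewrite !expgS wreathM /= IH.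
have -> : w ^+ #|I| = base (w ^+ #|I|).1.
  rewrite [LHS]surjective_pairing w2; congr pair.
  by rewrite -cardsT expg_cardG ?inE.
by rewrite baseX; congr pair; apply/ffunP => k; rewrite !ffunE Be.
Qed.

Section Pair.
Variables (z : I) (al be : B).
Hypothesis zU : uniq [:: 1; z; z ^+ 2; z ^+ 3; z ^+ 4].

(** Conjugation of the shift [x] by [base twist] gives an element [y] for
    which [y * x^-1] lies in the base group and is supported on [1], [z] and
    [z ^+ 2], with values [al], [be] and [(be * al)^-1]. *)
Definition twist : {ffun I -> B} :=
  [ffun k => if k == 1 then al else if k == z then be * al else 1].
Definition gen_x : wreath := shift z.
Definition gen_y : wreath := gen_x ^ (base twist)^-1.

Let x := gen_x.
Let y := gen_y.
Let c k := if k == 1 then al else if k == z then be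
           else if k == z ^+ 2 then (be * al)^-1 else 1.
Let spot (b : B) := base [ffun k => if k == z ^+ 2 then b else 1].

Let xyE : y * x^-1 = base (finfun c).
Proof.
have [z1 z2] : 1 != z /\ 1 != z ^+ 2.
  by move: zU; rewrite /= !inE !negb_or => /andP[/and4P[]].
have -> : y * x^-1 = base twist * (base twist)^-1 ^ x^-1.
  by rewrite /y /gen_y /x !conjgE !invgK !mulgA.
rewrite baseV /x /gen_x shiftV base_shift baseM; congr base.
apply/ffunP => k; rewrite !ffunE /c.
have e j : (z^-1 * k == j) = (k == z * j).
  by rewrite -(inj_eq (mulgI z)) mulKVg.
rewrite !e mulg1 -expg2.
case: (altP (k =P 1)) => [->|k1].
  by rewrite (negPf z1) (negPf z2) invg1 mulg1.
case: ifP => _; first by rewrite mulgK.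
by case: ifP => _; rewrite mul1g ?invg1.
Qed.

Let Q := <<[set x; y]>>.
(* [t2] is [t] moved by two places, so that the supports share [z ^+ 2]. *)
Let t := base (finfun c).
Let t2 := t ^ (x^-1 ^+ 2).

Let Qx : x \in Q. Proof. by apply: mem_gen; rewrite !inE eqxx. Qed.
Let Qy : y \in Q. Proof. by apply: mem_gen; rewrite !inE eqxx orbT. Qed.
Let Qt : t \in Q. Proof. by rewrite /t -xyE groupM ?groupV. Qed.
Let Qt2 : t2 \in Q. Proof. by rewrite groupJ ?groupX ?groupV. Qed.

Let t2E : t2 = base [ffun k => c (z^-1 ^+ 2 * k)].
Proof.
rewrite /t2 /x /gen_x shiftV shiftX base_shift; congr base.
by apply/ffunP => k; rewrite !ffunE.
Qed.

Let c_shift k : c (z^-1 ^+ 2 * k) =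
  if k == z ^+ 2 then al else if k == z ^+ 3 then be
  else if k == z ^+ 4 then (be * al)^-1 else 1.
Proof.
have e j : (z^-1 ^+ 2 * k == j) = (k == z ^+ 2 * j).
  by rewrite -(inj_eq (mulgI (z ^+ 2))) expgVn mulKVg.
by rewrite /c !e mulg1 -expgSr -expgD.
Qed.

Let Qspot n : spot ([~ (be * al)^-1, al] ^ (al ^+ n)) \in Q.
Proof.
have -> : spot ([~ (be * al)^-1, al] ^ (al ^+ n)) = [~ t, t2] ^ (t2 ^+ n).
  rewrite t2E baseX baseR baseJ; congr base; apply/ffunP => k.
  rewrite !ffunE c_shift.
  case: (altP (k =P z ^+ 2)) => [->|k2].
    have := zU; rewrite /c /= !inE => /and5P[]; rewrite !negb_or.
    move=> /and4P[_ z2 _ _] /and3P[z12 _ _] _ _ _.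
    by rewrite eq_sym (negPf z2) eq_sym (negPf z12) eqxx.
  rewrite /c (negPf k2).
  case: (altP (k =P 1)) => [->|k1].
    have := zU; rewrite /= !inE => /and5P[]; rewrite !negb_or.
    by move=> /and4P[_ _ /negPf-> /negPf->] _ _ _ _; rewrite commg1 conj1g.
  case: (altP (k =P z)) => [->|kz].
    have := zU; rewrite /= !inE => /and5P[_]; rewrite !negb_or.
    by move=> /and3P[_ /negPf-> /negPf->] _ _ _; rewrite commg1 conj1g.
  by rewrite comm1g conj1g.
by rewrite groupJ ?groupR ?groupX.
Qed.

(** The element [t = y * x^-1] and its conjugate by [x^-1 ^+ 2] have supports
    in [{1, z, z^2}] and [{z^2, z^3, z^4}]. These meet in one point, so the
    commutator is supported there, and conjugating it by powers of the second
    element, whose value there is [al], gives its conjugates under [al]. *)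
Lemma wreath_pair_card :
  #|<<[set [~ (be * al)^-1, al] ^ (al ^+ n) | n : 'I_#[al]]>>| <= #|Q|.
Proof.
have spot_inj : injective spot.
  by move=> a b [] /ffunP/(_ (z ^+ 2)); rewrite !ffunE eqxx.
rewrite -(card_imset _ spot_inj); apply: subset_leq_card.
apply/fintype.subsetP => _ /imsetP[b bU ->].
have spotM : {morph spot : a b / a * b}.
  move=> a b'; rewrite /spot baseM; congr base; apply/ffunP => k.
  by rewrite !ffunE; case: ifP; rewrite ?mulg1.
pose V := [set a | spot a \in Q].
have gV : group_set V.
  apply/group_setP; split=> [|a a'].
    rewrite inE (_ : spot 1 = 1) ?group1//.
    by congr pair; apply/ffunP => k; rewrite !ffunE if_same.
  by rewrite !inE spotM => ? ?; rewrite groupM.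
suff : b \in Group gV by rewrite inE.
move: b bU; apply/fintype.subsetP; rewrite gen_subG.
by apply/fintype.subsetP => _ /imsetP[n _ ->]; rewrite inE Qspot.
Qed.

End Pair.
End Wreath.

Section Lamplighter.
Import fingroup cyclic.
Local Open Scope group_scope.
Variables (I C : finGroupType) (s : I) (ga : C).
Hypotheses (s_gen : <[s]> = [set: I]) (ga1 : ga != 1).
Local Notation W := (wreath I C).

Definition lamp (k : I) : W := base [ffun j => if j == k then ga else 1].
Local Notation al := (shift C s).
Local Notation be := (lamp 1).

(** The commutator is [lamp 1 * (lamp s^-1)^-1]; its conjugates under the shift
    telescope to [lamp 1 * (lamp k)^-1] for all [k], and the products of these
    realize every set of lit lamps away from [1]. *)
Lemma lamplighter_card :
  2 ^ #|I|.-1 <= #|<<[set [~ (be * al)^-1, al] ^ (al ^+ n) | n : 'I_#[al]]>>|.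
Proof.
set U := <<_>>.
have lampJ k n : lamp k ^ (al ^+ n) = lamp (s ^- n * k).
  rewrite shiftX base_shift; congr base; apply/ffunP => j; rewrite !ffunE.
  by rewrite -(inj_eq (mulgI (s ^- n))) mulKg.
have Ustep n : lamp (s ^- n) * (lamp (s ^- n.+1))^-1 \in U.
  have -> : lamp (s ^- n) * (lamp (s ^- n.+1))^-1 =
      [~ (be * al)^-1, al] ^ (al ^+ (n %% #[al])).
    rewrite expg_mod_order commgEl invgK conjgE invMg !mulgA mulgK.
    rewrite (_ : be / al / be * al = be * be^-1 ^ al); last first.
      by rewrite conjgE !mulgA.
    rewrite conjMg.
    have -> : (be^-1 ^ al) = (lamp (s^-1))^-1.
      by rewrite conjVg -[al in _ ^ al]expg1 lampJ mulg1 expg1.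
    by rewrite conjVg !lampJ mulg1 -invMg -expgS.
  apply: mem_gen; apply/imsetP.
  by exists (Ordinal (ltn_pmod n (order_gt0 al))).
have Ud k : lamp 1 * (lamp k)^-1 \in U.
  have /cycleP[n] : k^-1 \in <[s]> by rewrite s_gen inE.
  move/(canRL invgK) => ->.
  elim: n => [|n IH]; first by rewrite expg0 invg1 mulgV group1.
  have := groupM IH (Ustep n).
  by rewrite mulgA mulgKV.
have UA (A : {set I}) : exists2 u, u \in U & u.2 = 1 /\
    forall j, j != 1 -> u.1 j = if j \in A then ga^-1 else 1.
  have [n] := ubnP #|A|; elim: n A => // n IH A.
  have [->|[k kA]] := set_0Vmem A.
    exists 1; first exact: group1.
    by split=> // j _; rewrite inE /= ffunE.
  rewrite (cardsD1 k) kA => /IH[u Uu [u2 u1]].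
  exists (u * (lamp 1 * (lamp k)^-1)); first by rewrite groupM.
  rewrite /lamp baseV baseM wreathM /= u2 mulg1; split=> // j j1.
  rewrite !ffunE u1// !inE invg1 mul1g (negPf j1) mul1g.
  by case: (altP (j =P k)) => [->|_] /=; rewrite ?kA ?mul1g ?invg1 ?mulg1.
pose P := powerset [set~ (1 : I)].
have -> : (2 ^ #|I|.-1)%N = #|P|.
  by rewrite card_powerset cardsC1.
apply: leq_trans
  (leq_imset_card (fun u : W => [set j | j != 1 & u.1 j != 1]) U).
apply: subset_leq_card; apply/fintype.subsetP => A.
rewrite powersetE => /fintype.subsetP A1.
have [u Uu [_ u1]] := UA A; apply/imsetP; exists u => //.
apply/setP => j; rewrite inE; have [->|j1] := eqVneq j 1.
  by apply/negP => /A1; rewrite !inE eqxx.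
by rewrite u1//=; case: ifP => _; rewrite ?eqxx// invg_eq1 ga1.
Qed.

End Lamplighter.

(** For [n + 1 = 2^k] the left side is at most [2^((a + k) d)], and [(a + k) d]
    is less than [2^k - 1] for large [k]. *)
Lemma linear_power_lt_exp2 a d : exists n, (a * n.+1) ^ d < 2 ^ n.
Proof.
case: d => [|d]; first by exists 1%N.
pose c := (a.+1 * d.+1)%N; pose k := c.*2.*2.
have le2 n : n < 2 ^ n by apply: ltn_expl.
exists (2 ^ k).-1; rewrite prednK ?expn_gt0//.
apply: (@leq_ltn_trans (2 ^ ((a + k) * d.+1))).
  by rewrite expnM leq_exp2r// expnD leq_mul2r (ltnW (le2 a)) orbT.
rewrite ltn_exp2l// -ltnS prednK ?expn_gt0//.
have h1 : ((a + k) * d.+1).+1 <= c * k.+1.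
  rewrite /c mulnAC -addn1 mulnSr [in leqRHS]mulnSr addnC; lia.
have h2 : c * k.+1 < 2 ^ k.
  rewrite /k -!muln2 -mulnA expnM.
  apply: leq_trans (_ : c.+1 ^ 4 <= _); last by rewrite leq_exp2r.
  by rewrite !expnS expn0; nia.
exact: leq_ltn_trans h1 h2.
Qed.

Section CyclicOrdinal.
Import fingroup cyclic zmodp.
Local Open Scope group_scope.
Variable n : nat.

Lemma ord_expg (k : nat) : (inZp 1 : 'I_n.+1) ^+ k = inZp k.
Proof.
elim: k => [|k IH]; first by apply: val_inj; rewrite /= mod0n.
by rewrite expgS IH; apply: val_inj; rewrite /= modnDml modnDmr add1n.
Qed.

Lemma ord_cycle : <[inZp 1 : 'I_n.+1]> = [set: 'I_n.+1].
Proof.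
apply/setP => i; rewrite inE; apply/cycleP; exists i.
by rewrite ord_expg; apply: val_inj; rewrite /= modn_small.
Qed.

End CyclicOrdinal.

Section FiniteGroups.
Import fingroup cyclic zmodp.
Local Open Scope group_scope.

Lemma card_mulg_leq (W : finGroupType) (A B : {set W}) :
  #|A * B| <= #|A| * #|B|.
Proof.
by rewrite -cardsX -[A * B]/(mulg @2: (A, B)) curry_imset2X leq_imset_card.
Qed.

(** The group [W] is the wreath product by [Z/m] of the lamplighter group
    [Z/2 wr Z/(n+1)], of exponent dividing [2 m (n+1)]; the subgroup generated
    by the pair has at least [2^n] elements. *)
Lemma finite_groups_not_bounded m d : 4 < m ->
  exists (W : finGroupType) (x y : W) (e : nat),
  [/\ x ^+ m = 1, y ^+ m = 1, forall w : W, w ^+ e = 1, 0 < e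
    & e ^ d < #|<<[set x; y]>>|].
Proof.
case: m => // m m4.
have [n nP] := linear_power_lt_exp2 (m.+1 * 2) d.
pose I := 'I_m.+1; pose J := 'I_n.+1; pose C := 'I_2.
pose z : I := inZp 1; pose s : J := inZp 1; pose ga : C := inZp 1.
pose al := shift C s; pose be := lamp ga (1 : J).
have zU : uniq [:: 1; z; z ^+ 2; z ^+ 3; z ^+ 4].
  rewrite /z !ord_expg -(map_inj_uniq val_inj) /= !modn_small//; lia.
have Xm : shift (wreath J C) z ^+ m.+1 = 1.
  by rewrite shiftX /z ord_expg; congr pair; apply: val_inj; rewrite /= modnn.
exists (wreath I (wreath J C)), (gen_x _ z), (gen_y z al be).
exists (m.+1 * (n.+1 * 2))%N.
split=> //.
- by rewrite -conjXg Xm conj1g.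
- have c2 (c : C) : c ^+ 2 = 1.
    by rewrite -[2](card_ord 2) -cardsT expg_cardG ?inE.
  move=> w; have := wreath_exponent (wreath_exponent c2) w.
  by rewrite !card_ord.
- apply: leq_trans (wreath_pair_card _ _ zU).
  apply: leq_trans (lamplighter_card (ord_cycle n) _) => //.
  by rewrite card_ord [(n.+1 * 2)%N]mulnC mulnA.
Qed.

End FiniteGroups.

(** * Subgroups of finite index *)

Local Open Scope classical_set_scope.
Local Open Scope card_scope.
Local Open Scope group_scope.

Lemma expg_modn (G : groupType) (x : G) m n :
  x ^+ m = 1 -> x ^+ (n %% m) = x ^+ n.
Proof.
move=> xm; rewrite [in RHS](divn_eq n m) expgnDr mulnC expgnA xm.
by rewrite expg1n mul1g.
Qed.

Section Index.
Variables (G : groupType) (F : finType) (f : G -> F).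
Hypothesis f_surj : forall y, exists x, f x = y.

Lemma has_index_fin (K : subgroup G) :
  (forall x y, f x = f y <-> sg_set K (x^-1 * y)) -> has_index (sg_set K) #|F|.
Proof.
move=> fK; have [g gK] := choice f_surj.
rewrite /has_index -(card_eqr (card_fin F)).
pose h y := lcoset K (g y).
have hinj : {in [set: F] &, injective h}.
  by move=> y z _ _ /lcoset_eq/fK; rewrite !gK.
rewrite -(card_eqr (inj_card_eq hinj)).
suff -> : h @` [set: F] = lcosets (sg_set K) by apply: card_eqxx.
apply/seteqP; split=> [_ [y _ <-]|_ [x _ <-]]; first exact: imageT.
by exists (f x) => //; apply/lcoset_eq/fK; rewrite gK.
Qed.

(** The set [F] stands for the quotient group: its group law is determined by
    the two congruence hypotheses, and the subgroup is the kernel. *)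
Lemma congruence_pi_normal (pi : nat_pred) :
  (forall x y z, f x = f y -> f (x * z) = f (y * z)) ->
  (forall x y z, f x = f y -> f (z * x) = f (z * y)) ->
  pi.-nat #|F| -> exists N : pi_normal pi G, forall x, sg_set N x <-> f x = f 1.
Proof.
move=> fMl fMr pF.
have Nsg : is_subgroup [set x | f x = f 1].
  split=> [|x y /set_mem/= fx /set_mem/= fy]; apply/mem_set => //=.
  rewrite (fMl _ _ _ fx) mul1g.
  by have /esym := fMl _ _ y^-1 fy; rewrite mulgV mul1g.
have Nns x y : sg_set (Subgroup Nsg) x -> sg_set (Subgroup Nsg) (x ^ y).
  move=> /= fx; rewrite conjgE.
  by rewrite (fMr _ (1 * y)); [rewrite mul1g mulVg|apply: fMl].
have Ni : exists2 n, pi.-nat n & has_index (sg_set (NormalSubgroup Nns)) n.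
  exists #|F| => //; apply: has_index_fin => x y /=; split=> [/esym e|e].
    by rewrite (fMr _ _ _ e) mulVg.
  by have := fMr _ _ x e; rewrite mulVKg mulg1.
by exists (PiNormal Ni).
Qed.

End Index.

Lemma residuallyP (pi : nat_pred) (G : groupType) :
  (forall x : G, x <> 1 -> exists N : pi_normal pi G, ~ sg_set N x) ->
  residually pi G.
Proof.
move=> res x y exy; apply: contrapT => nxy.
have [|N] := res (x^-1 * y).
  by move=> e; apply: nxy; apply: (@mulgI _ x^-1); rewrite mulVg e.
apply; apply/coset_eq.
exact: (congr1 (fun z : completion pi G => val z N) exy).
Qed.

Lemma residually_eq1 (pi : nat_pred) (G : groupType) (x : G) :
  residually pi G -> (forall N : pi_normal pi G, sg_set N x) -> x = 1.
Proof.
move=> res xN; apply: res; apply/val_inj/functional_extensionality_dep => N.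
by apply/coset_eq; rewrite mulg1; apply: sgV; apply: xN.
Qed.

Section FinQuotient.
Import fingroup cyclic.

(** Lagrange's theorem in the quotient by [N]. *)
Lemma pi_normal_expg (pi : nat_pred) (G : groupType) (N : pi_normal pi G) :
  exists2 n, pi.-nat n & forall x, sg_set N (x ^+ n).
Proof.
have [n pi_n Nn] := pn_index N; exists n => // x.
have Qn : [set: quot N] #= `I_n by rewrite (card_eql (card_setT _)).
have [f [g fK gK]] := card_fin_bij Qn.
pose cB := CanIsCountable fK.
have enumP : Finite.axiom [seq g i | i <- enum 'I_n].
  move=> y; rewrite count_uniq_mem ?(map_inj_uniq (can_inj gK)) ?enum_uniq//.
  by apply/eqP; rewrite eqb1 -[y]fK map_f ?mem_enum.
pose fB := isFinite.Build (quot N) enumP.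
pose T : finGroupType := HB.pack (quot N : Type) (Group.class (quot N)) cB fB.
have nT : n = #|T|.
  by rewrite -[n]card_ord; apply: esym; apply: (@bij_eq_card T _ f); exists g.
have : (coset N x : T) ^+ n = 1%g by rewrite nT -cardsT expg_cardG ?inE.
have <- : coset N (x ^+ n) = (coset N x : T) ^+ n.
  elim: (n) => [|k IH]; first by [].
  by rewrite !(@expgS) cosetM IH.
by move=> /esym/coset_eq; rewrite invg1 mul1g.
Qed.

Lemma trivial_pi_normal (pi : nat_pred) (W : finGroupType) : pi.-nat #|W| ->
  exists N : pi_normal pi W, forall x, sg_set N x <-> x = 1.
Proof.
move=> piW; have [|x y z ->|x y z ->|N NE] // :=
  @congruence_pi_normal W W id _ pi _ _ piW; first by move=> y; exists y.
by exists N.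
Qed.

Lemma finGroup_predT (W : finGroupType) : predT.-nat #|W|.
Proof. by rewrite /pnat -cardsT cardG_gt0; apply/allP. Qed.

End FinQuotient.

(** * Completions *)

(** The compactness argument behind every passage to the limit below: a
    directed family of closed conditions that can be met one at a time can be
    met simultaneously. *)
Lemma compact_directed (T : topologicalType) (A : set T) (J : Type)
    (D : J -> set T) :
  compact A -> inhabited J -> (forall i, closed (D i)) ->
  (forall i, A `&` D i !=set0) ->
  (forall i j, exists k, D k `<=` D i `&` D j) ->
  exists2 x, A x & forall i, D i x.
Proof.
move=> Aco [i0] Dcl Dn0 Ddir.
pose F := filter_from [set: J] (fun i => A `&` D i).
have FF : ProperFilter F.
  apply: filter_from_proper; last by move=> i _; apply: Dn0.
  apply: filter_from_filter; first by exists i0.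
  move=> i j _ _; have [k Dk] := Ddir i j; exists k => // x [Ax /Dk[Di Dj]].
  by split; split.
have [|x [Ax xF]] := Aco F FF; first by exists i0 => // x [].
exists x => // i; apply: Dcl => U Ux.
have FD : F (A `&` D i) by exists i.
by have [y [[_ Dy] Uy]] := xF _ U FD Ux; exists y.
Qed.

Section CompletionTopology.
Variables (pi : nat_pred) (G : groupType).
Local Notation C := (completion pi G).

Lemma completion_eq (x y : C) : (forall N, val x N = val y N) -> x = y.
Proof. by move=> e; apply/val_inj/functional_extensionality_dep. Qed.

Lemma to_completionM (x y : G) :
  to_completion pi (x * y) = to_completion pi x * to_completion pi y :> C.
Proof. by apply: completion_eq => N; apply: cosetM. Qed.

HB.instance Definition _ :=
  isMultiplicative.Build G C (@to_completion pi G) to_completionM.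

Lemma completion_coset (x : C) (N : pi_normal pi G) :
  exists g, val x N = val (to_completion pi g) N.
Proof. by have [g ->] := coset_surj (val x N); exists g. Qed.

Lemma coord_nbhs (x : C) (N : pi_normal pi G) :
  nbhs x [set y : C | val y N = val x N].
Proof.
have : val y N @[y --> x] --> val x N.
  apply: (@prod_proj_cvg _ _ _ (nbhs x) (fun y : C => val y) (val x) N).
  exact: (@val_cvg _ _ _ (nbhs x) idfun x (nbhs_filter x)).
by move=> /(_ [set val x N]); apply; apply: discrete_set1.
Qed.

Lemma coord_open (N : pi_normal pi G) (A : set (quot N)) :
  open [set x : C | A (val x N)].
Proof.
rewrite openE => x Ax; apply: filterS (coord_nbhs x N) => y /= yx.
by rewrite yx.
Qed.

Lemma coord_closed (N : pi_normal pi G) (A : set (quot N)) :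
  closed [set x : C | A (val x N)].
Proof. by rewrite -openC; apply: (@coord_open N (~` A)). Qed.

(** A completion is closed in a product of finite discrete groups, which is
    compact by Tychonoff's theorem. *)
Lemma completion_compact : compact [set: C].
Proof.
pose P := prod_topology (fun N : pi_normal pi G => quot N).
have Pco : compact [set: P].
  have := @tychonoff _ (fun N : pi_normal pi G => quot N) (fun=> setT).
  rewrite (_ : [set f | _] = [set: P]); last by apply/seteqP; split.
  apply=> N; apply: finite_compact; have [n _ Nn] := pn_index N.
  by exists n; rewrite (card_eql (card_setT _)).
have Ccl : closed (@compatible pi G).
  rewrite -openC openE => x /existsNP[M /existsNP[N /existsNP[s ne]]].
  have cN (K : pi_normal pi G) : \forall y \near x, (y : P) K = x K.
    have : (y : P) K @[y --> x] --> x K.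
      exact: (@prod_proj_cvg _ _ _ (nbhs x) idfun x K (nbhs_filter x)).
    by move=> /(_ [set x K]); apply; apply: discrete_set1.
  apply: filterS2 (cN M) (cN N) => y yM yN /(_ M N s); rewrite yM yN.
  exact: ne.
have cC : compact (@compatible pi G).
  by rewrite -(setTI (@compatible pi G)); apply: compact_closedI.
move=> F FF _; have [|l [cl Fl]] := cC (val @ F) _.
  apply: (@filterS _ F _ setT) => [[x Cx] _|]; last exact: filterT.
  exact: set_mem Cx.
exists (SigSub (mem_set cl)); split=> // A B FA [_ [[V oV <-] /= Vl] VB].
have [|_ [[x Ax <-] Vx]] := Fl (val @` A) V _ (open_nbhs_nbhs (conj oV Vl)).
  by apply: (@filterS _ F _ A) => // x Ax; exists x.
by exists x; split=> //; apply: VB.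
Qed.

(** Elements of a completion that agree in one coordinate agree in all
    coarser ones, so the coordinate conditions are directed. *)
Lemma compact_coord (A : set C) (y : C) : compact A ->
  (forall N, exists2 x, A x & val x N = val y N) -> A y.
Proof.
move=> Aco Ay.
have [|N|N|M N|x Ax xy] := @compact_directed C A (pi_normal pi G)
    (fun N => [set x : C | val x N = val y N]) Aco.
- exact/inhabits/full_pn.
- exact: (@coord_closed N [set val y N]).
- by have [x Ax xy] := Ay N; exists x.
- exists (cap_pn M N) => x /= xy.
  have s (K : pi_normal pi G) (s : forall z, sg_set (cap_pn M N) z ->
      sg_set K (idfun z)) : val x K = val y K.
    rewrite -(set_mem (valP x) _ _ s) -(set_mem (valP y) _ _ s).
    by congr (quot_map s _); apply: xy.
  by split; apply: s => z [].
- by rewrite -(completion_eq xy).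
Qed.

Lemma closed_compact_completion (A : set C) : closed A -> compact A.
Proof.
by move=> Acl; rewrite -(setTI A); apply: compact_closedI completion_compact _.
Qed.

Lemma compact_setM (A B : set C) : compact A -> compact B -> compact (setM A B).
Proof.
move=> Aco Bco.
have -> : setM A B = (fun x : C * C => x.1 * x.2) @` (A `*` B).
  apply/seteqP; split=> [_ [x Ax [y By <-]]|_ [[x y] [Ax By] <-]].
    by exists (x, y).
  by exists x => //; exists y.
apply: continuous_compact; last exact: compact_setX.
exact/continuous_subspaceT/mulg_continuous.
Qed.

End CompletionTopology.

Section CompletionMapTheory.
Variables (pi : nat_pred) (G H : groupType) (f : {multiplicative G -> H}).
Local Notation fhat := (@completion_map pi G H f).

Lemma completion_map_coord (x : completion pi G) (N : pi_normal pi H) g :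
  val x (preim_pn f N) = coset _ g -> val (fhat x) N = coset N (f g).
Proof. by move=> xg; rewrite /= /completion_map_at xg quot_mapE. Qed.

Lemma completion_mapM : {morph fhat : x y / x * y}.
Proof.
move=> x y; apply: completion_eq => N.
have [g xg] := completion_coset x (preim_pn f N).
have [h yh] := completion_coset y (preim_pn f N).
rewrite (completion_map_coord (g := g * h)).
  by rewrite -[RHS]/(val (fhat x) N * val (fhat y) N)
    (completion_map_coord xg) (completion_map_coord yh) gmulfM cosetM.
by rewrite cosetM -[LHS]/(val x _ * val y _) xg yh.
Qed.

HB.instance Definition _ :=
  isMultiplicative.Build (completion pi G) (completion pi H) fhat
    completion_mapM.

Lemma completion_map_continuous : continuous fhat.
Proof.
move=> x; apply: (@sub_cvg _ _ _ (nbhs x)).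
apply: (@prod_cvg _ _ _ (nbhs x)) => N A /nbhs_singleton AN.
apply: filterS (coord_nbhs x (preim_pn f N)) => y xy.
suff e : val (fhat y) N = val (fhat x) N by move: AN; rewrite -e.
by congr (quot_map _ _); apply: xy.
Qed.

Lemma completion_map_coord_closed (N : pi_normal pi H) (A : set (quot N)) :
  closed [set x | A (val (fhat x) N)].
Proof.
apply: (@closed_comp _ _ fhat [set y | A (val y N)]); last exact: coord_closed.
by move=> x _; apply: completion_map_continuous.
Qed.

End CompletionMapTheory.

Lemma gmulf_gen (G H : groupType) (f : {multiplicative G -> H}) (A : set G) x :
  gen A x -> gen (f @` A) (f x).
Proof.
move=> Ax B [Bsg AB]; apply: (Ax [set y | B (f y)]); split.
  split; first by apply/mem_set; rewrite /= mulf1; apply/set_mem/Bsg.1.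
  move=> y z /set_mem/= By /set_mem/= Bz; apply/mem_set => /=.
  by rewrite gmulfM mulfV; apply/set_mem/Bsg.2; apply/mem_set.
by move=> y Ay; apply: AB; exists y.
Qed.

Lemma gen_is_subgroup (G : groupType) (A : set G) : is_subgroup (gen A).
Proof.
split=> [|x y /set_mem Ax /set_mem Ay]; apply/mem_set => B [Bsg AB].
  exact/set_mem/Bsg.1.
by apply/set_mem/Bsg.2; apply/mem_set; [apply: Ax|apply: Ay].
Qed.

Lemma sub_gen (G : groupType) (A : set G) : A `<=` gen A.
Proof. by move=> x Ax B [_]; apply. Qed.

Lemma gen_mono (G : groupType) (A B : set G) : A `<=` B -> gen A `<=` gen B.
Proof. by move=> AB x Ax C [Csg BC]; apply: Ax; split=> // y /AB/BC. Qed.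

Lemma bounded_finitely_generated (G : groupType) :
  boundedly_generated G -> finitely_generated G.
Proof.
case=> gs gsT; exists [set` gs]; first by apply/finite_seqP; exists gs.
apply/seteqP; split=> // x _; have : [set: G] x by []; rewrite -{}gsT.
pose K := Subgroup (gen_is_subgroup [set` gs]).
suff sK s : {subset s <= gs} ->
    \big[@setM G/[set 1]]_(g <- s) gen [set g] `<=` sg_set K by apply: sK.
elim: s => [_|g s IH sgs]; first by rewrite big_nil => _ ->; apply: sg1.
rewrite big_cons => _ [y gy [z sz <-]]; apply: sgM; last first.
  by apply: IH sz => w ws; apply: sgs; rewrite inE ws orbT.
by apply: gen_mono gy => _ ->; rewrite /= sgs ?mem_head.
Qed.

Section SetProducts.
Variables (G H : groupType).

Lemma big_setM_sub (gs : seq G) (A B : G -> set G) :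
  (forall g, A g `<=` B g) ->
  \big[@setM G/[set 1]]_(g <- gs) A g `<=` \big[@setM G/[set 1]]_(g <- gs) B g.
Proof.
move=> AB; elim: gs => [|g gs IH]; first by rewrite !big_nil.
by rewrite !big_cons => _ [x /AB Bx [y /IH By <-]]; exists x => //; exists y.
Qed.

Lemma big_setM_image (f : {multiplicative G -> H}) (gs : seq G) x :
  (\big[@setM G/[set 1]]_(g <- gs) gen [set g]) x ->
  (\big[@setM H/[set 1]]_(h <- map f gs) gen [set h]) (f x).
Proof.
elim: gs x => [|g gs IH] x; first by rewrite !big_nil => ->; apply: mulf1.
rewrite /= !big_cons => -[y gy [z /IH fz <-]]; rewrite gmulfM.
exists (f y); last by exists (f z).
by rewrite -image_set1; apply: gmulf_gen.
Qed.

End SetProducts.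

(** A product of procyclic subgroups is compact, so it is everything as soon
    as it contains the dense image of [H]. *)
Lemma completion_boundedly_generated (pi : nat_pred) (G H : groupType)
    (f : {multiplicative G -> H}) :
  (forall y : H, exists x : G, to_completion pi (f x) = to_completion pi y) ->
  boundedly_generated G -> top_boundedly_generated (completion pi H).
Proof.
move=> f_surj [gs gsT].
exists (map (@to_completion pi H) (map f gs)).
apply/seteqP; split=> // y _; apply: compact_coord => [|N].
  elim: (map _ _) => [|h hs IH].
    by rewrite big_nil; apply: compact_set1.
  rewrite big_cons; apply: compact_setM => //.
  exact/closed_compact_completion/closed_closure.
have [z yz] := completion_coset y N; have [x fx] := f_surj z.
exists (to_completion pi (f x)); last by rewrite fx yz.
apply: (big_setM_sub (fun g => @subset_closure _ (gen [set g]))).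
by do 2!apply: big_setM_image; rewrite gsT.
Qed.

Section DenseSubgroup.
Variables (pi : nat_pred) (G : groupType) (K : subgroup G).
Hypothesis dK : forall (N : pi_normal pi G) (x : G),
  exists2 y, sg_set K y & sg_set N (x^-1 * y).
Local Notation phi := (@completion_map pi K G (@sg_incl G K)).

Lemma dense_pro_topology : dense (sg_set K : set (pro_topology pi G)).
Proof.
move=> U [x Ux] oU; have [N NU] := oU x Ux; have [y Ky Ny] := dK N x.
by exists y; split=> //; apply: NU; apply/lcosetP.
Qed.

Lemma dense_completion_surj (y : completion pi G) : exists x, phi x = y.
Proof.
have [||N|N|M N|x _ xy] := @compact_directed (completion pi K) setT
    (pi_normal pi G) (fun N => [set x | val (phi x) N = val y N]).
- exact: completion_compact.
- exact/inhabits/full_pn.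
- exact: (completion_map_coord_closed (A := [set val y N])).
- have [g yg] := completion_coset y N; have [k Kk Nk] := dK N g.
  exists (to_completion pi (SigSub (mem_set Kk) : K)); split=> //=.
  by rewrite /completion_map_at quot_mapE yg; apply/esym/coset_eq.
- exists (cap_pn M N) => x xy.
  have s (L : pi_normal pi G) (s : forall z, sg_set (cap_pn M N) z ->
      sg_set L (idfun z)) : val (phi x) L = val y L.
    rewrite -(set_mem (valP (phi x)) _ _ s) -(set_mem (valP y) _ _ s).
    by congr (quot_map s _); apply: xy.
  by split; apply: s => z [].
- by exists x; apply: completion_eq.
Qed.

End DenseSubgroup.

(** If the map were injective, a subgroup of [K] that is open in the pro-[pi]
    topology of [K] would be open in the topology induced from [G]: otherwise
    the elements of [K] lying in each [N] but not in [M] would accumulate at a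
    nontrivial element of the kernel. *)
Lemma completion_map_not_inj (pi : nat_pred) (G : groupType) (K : subgroup G)
    (M : pi_normal pi K) :
  (forall N : pi_normal pi G, exists2 k : K, sg_set N (val k) & ~ sg_set M k) ->
  ~ injective (@completion_map pi K G (@sg_incl G K)).
Proof.
move=> Mtop phi_inj; set phi := completion_map _ in phi_inj.
have [||N|N|N N'|x _ xP] := @compact_directed (completion pi K) setT
    (pi_normal pi G) (fun N => [set x | val x M <> 1] `&`
       [set x | val (phi x) N = 1]).
- exact: completion_compact.
- exact/inhabits/full_pn.
- apply: closedI; first exact: (@coord_closed _ _ M [set c | c <> 1]).
  exact: (completion_map_coord_closed (A := [set 1])).
- have [k Nk Mk] := Mtop N; exists (to_completion pi k); split=> //; split=> /=.
    by move=> /esym/coset_eq; rewrite invg1 mul1g.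
  rewrite /completion_map_at quot_mapE; apply/esym/coset_eq.
  by rewrite invg1 mul1g.
- exists (cap_pn N N') => x [xM xN].
  have s (L : pi_normal pi G) (s : forall z, sg_set (cap_pn N N') z ->
      sg_set L (idfun z)) : val (phi x) L = 1.
    rewrite -(set_mem (valP (phi x)) _ _ s) -[RHS](mulf1 (quot_map s)).
    by congr (quot_map s _); apply: xN.
  by split; split=> //; apply: s => z [].
- have x1 : x = 1.
    apply: phi_inj; rewrite [RHS]mulf1; apply: completion_eq => N.
    by have [_ /= ->] := xP N.
  have [/= + _] := xP (full_pn G pi); rewrite x1; exact.
Qed.

Section Descent.
Variables (pi : nat_pred) (G B : groupType) (f : {multiplicative G -> B}).
Variable N : pi_normal pi G.
Hypothesis NE : forall x, sg_set N x <-> f x = 1.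

(** A homomorphism to a finite group factors through a single coordinate of
    the completion, hence extends to a locally constant homomorphism; the last
    clause is this local constancy. *)
Lemma completion_descent : exists h : {multiplicative completion pi G -> B},
  (forall g, h (to_completion pi g) = f g) /\
  (forall y (S : set (completion pi G)), closure S y -> (h @` S) (h y)).
Proof.
have [r rK] := choice (@coset_surj G N).
have fr g : f (r (coset N g)) = f g.
  have /esym/coset_eq/NE := rK (coset N g); rewrite gmulfM mulfV => e.
  by rewrite -[RHS](mulVKg (f (r (coset N g)))) e mulg1.
pose h (y : completion pi G) := f (r (val y N)).
have hM : {morph h : x y / x * y}.
  move=> x y; have [g xg] := completion_coset x N.
  have [g' yg'] := completion_coset y N.
  rewrite /h -[val (x * y) N]/(val x N * val y N) xg yg'.
  by rewrite -cosetM !fr gmulfM.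
pose mh := isMultiplicative.Build (completion pi G) B h hM.
exists (HB.pack_for {multiplicative completion pi G -> B} h mh).
split=> [g|y S clS]; first exact: fr.
have [z [Sz zy]] := clS _ (coord_nbhs y N).
by exists z => //; apply: (congr1 (f \o r) zy).
Qed.

End Descent.

(** * Semidirect products of a ring by a unit *)

Section IntPowers.
Import GRing.Theory Num.Theory.
Local Open Scope ring_scope.
Local Open Scope classical_set_scope.
Variables (A : comNzRingType) (u v : A).
Hypothesis uv : u * v = 1.

(** [u ^ j] for an integer [j], where [v] is the inverse of [u]. *)
Definition int_pow (j : int) : A :=
  match j with Posz n => u ^+ n | Negz n => v ^+ n.+1 end.

Lemma int_powB m n : int_pow (m%:Z - n%:Z) = u ^+ m * v ^+ n.
Proof.
have [nm|/ltnW mn] := leqP n m.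
  rewrite subzn//= -{2}(subnK nm) exprD -mulrA -exprMn uv expr1n mulr1.
  by [].
rewrite -opprB subzn// -{2}(subnK mn) exprD [v ^+ _ * _]mulrC mulrA -exprMn uv.
rewrite expr1n mul1r; case: (n - m)%N => [|k] /=; first by rewrite !expr0.
by [].
Qed.

Lemma int_diff (j : int) : exists m n : nat, j = m%:Z - n%:Z.
Proof.
case: j => n; first by exists n, 0%N; rewrite subr0.
by exists 0%N, n.+1; rewrite sub0r NegzE.
Qed.

Lemma int_powD i j : int_pow (i + j) = int_pow i * int_pow j.
Proof.
have [a [b ->]] := int_diff i; have [c [d ->]] := int_diff j.
rewrite addrACA -opprD -!PoszD !int_powB !exprD.
by rewrite mulrACA.
Qed.

Lemma int_powN j : int_pow j * int_pow (- j) = 1.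
Proof. by rewrite -int_powD subrr. Qed.

Lemma int_pow_period (R : comNzRingType) (f : {rmorphism A -> R}) n z :
  f u ^+ n = 1 -> f (int_pow (n%:Z * z)) = 1.
Proof.
move=> fun1; have [a [b ->]] := int_diff z.
have fvn : f v ^+ n = 1.
  by rewrite -[LHS]mul1r -fun1 -exprMn -rmorphM uv rmorph1 expr1n.
rewrite mulrBr -!PoszM int_powB rmorphM !rmorphXn /= !exprM fun1 fvn.
by rewrite !expr1n mulr1.
Qed.

End IntPowers.

Section Affine.
Import GRing.Theory Num.Theory.
Local Open Scope ring_scope.
Local Open Scope classical_set_scope.
Variables (A : comNzRingType) (u v : A) (uv : u * v = 1).
Local Notation pw := (int_pow u v).

(** The semidirect product [A ><| Z]; the element [(a, j)] is the affine map
    sending [t] to [t * u ^ j + a], and maps compose from left to right. *)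
Definition affine (_ : u * v = 1) : Type := (A * int)%type.
Local Notation H := (affine uv).
HB.instance Definition _ := Choice.on H.

Definition affine_mul (x y : H) : H := (x.1 * pw y.2 + y.1, x.2 + y.2).
Definition affine_one : H := (0, 0).
Definition affine_inv (x : H) : H := (- (x.1 * pw (- x.2)), - x.2).

Fact affine_mulA : associative affine_mul.
Proof.
move=> [a i] [b j] [c k]; rewrite /affine_mul /= !addrA; congr pair.
by rewrite int_powD// mulrDl -mulrA.
Qed.
Fact affine_mul1 : left_id affine_one affine_mul.
Proof. by move=> [a i]; rewrite /affine_mul /= mul0r !add0r. Qed.
Fact affine_mulr1 : right_id affine_one affine_mul.
Proof. by move=> [a i]; rewrite /affine_mul /= mulr1 !addr0. Qed.
Fact affine_mulV : left_inverse affine_one affine_inv affine_mul.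
Proof.
move=> [a i]; rewrite /affine_mul /= addNr mulNr -mulrA mulrC.
by rewrite [pw (- i) * _]mulrC int_powN// mul1r addNr.
Qed.
Fact affine_mulrV : right_inverse affine_one affine_inv affine_mul.
Proof. by move=> [a i]; rewrite /affine_mul /= addrN subrr. Qed.

HB.instance Definition _ := isGroup.Build H
  affine_mulA affine_mul1 affine_mulr1 affine_mulV affine_mulrV.

Lemma affineM (x y : H) : (x * y)%g = (x.1 * pw y.2 + y.1, x.2 + y.2).
Proof. by []. Qed.

Lemma affineV (x : H) : (x^-1)%g = (- (x.1 * pw (- x.2)), - x.2).
Proof. by []. Qed.

Definition translation (a : A) : H := (a, 0).
Definition rotation (j : int) : H := (0, j).

Lemma translationD a b :
  translation (a + b) = (translation a * translation b)%g.
Proof. by rewrite affineM /= mulr1 addr0. Qed.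

Lemma rotationD i j : rotation (i + j) = (rotation i * rotation j)%g.
Proof. by rewrite affineM /= mul0r addr0. Qed.

Lemma affine_split (x : H) : x = (rotation x.2 * translation x.1)%g.
Proof. by rewrite affineM /= mul0r add0r addr0; case: x. Qed.

Lemma rotationX j (n : nat) : (rotation j ^+ n)%g = rotation (j *+ n).
Proof. by elim: n => [|n IH] //; rewrite expgS IH mulrS rotationD. Qed.

End Affine.

Section IntHom.
Import GRing.Theory Num.Theory.
Local Open Scope ring_scope.
Local Open Scope classical_set_scope.

Lemma int_hom_gen (G : groupType) (f : int -> G) (z : int) :
  (forall i j, f (i + j) = (f i * f j)%g) -> gen [set f 1] (f z).
Proof.
move=> fD; pose K := Subgroup (gen_is_subgroup [set f 1]).
have f0 : f 0 = 1%g by apply: (@mulgI _ (f 0)); rewrite -fD addr0 mulg1.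
have Kf (n : nat) : sg_set K (f n%:Z).
  elim: n => [|n IH]; first by rewrite f0; apply: sg1.
  by rewrite intS fD; apply: sgM IH; apply: sub_gen.
rewrite -[gen _]/(sg_set K); case: z => n; first exact: Kf.
suff fN : f (Negz n) = ((f n.+1%:Z)^-1)%g by rewrite fN; apply: sgV (Kf n.+1).
by apply: (@mulgI _ (f n.+1%:Z)); rewrite -fD NegzE subrr mulgV.
Qed.

End IntHom.

Section BoundedGeneration.
Import GRing.Theory Num.Theory.
Local Open Scope ring_scope.
Local Open Scope classical_set_scope.
Variables (A : zmodType) (n : nat) (x : 'I_n -> A).
Hypothesis xA : forall a, exists c : 'I_n -> int, a = \sum_i x i *~ c i.
Variables (G : groupType) (th : A -> G) (rho : int -> G).
Hypothesis thD : forall a b, th (a + b) = (th a * th b)%g.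
Hypothesis rhoD : forall i j, rho (i + j) = (rho i * rho j)%g.
Hypothesis thG : forall g, exists z a, g = (rho z * th a)%g.

Lemma abelian_by_cyclic_bounded : boundedly_generated G.
Proof.
have gx i (z : int) : gen [set th (x i)] (th (x i *~ z)).
  have := @int_hom_gen G (fun z => th (x i *~ z)) z; rewrite /= mulr1z; apply.
  by move=> j k; rewrite mulrzDr thD.
exists (rho 1 :: [seq th (x i) | i <- enum 'I_n]).
apply/seteqP; split=> // g _; rewrite big_cons.
have [z [a ->]] := thG g; exists (rho z); first exact: int_hom_gen.
exists (th a) => //; have [c ->] := xA a; rewrite big_map.
have -> : \sum_i x i *~ c i = \sum_(i <- enum 'I_n) x i *~ c i.
  by rewrite big_enum.
elim: (enum 'I_n) => [|i s IH].
  rewrite !big_nil; apply: (@mulgI _ (th 0)).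
  by rewrite -thD addr0 mulg1.
rewrite !big_cons thD; exists (th (x i *~ c i)) => //.
by exists (th (\sum_(j <- s) x j *~ c j)).
Qed.

End BoundedGeneration.

Section AffineProperties.
Import GRing.Theory Num.Theory.
Local Open Scope ring_scope.
Local Open Scope classical_set_scope.
Variables (A : comNzRingType) (u v : A) (uv : u * v = 1).
Local Notation pw := (int_pow u v).
Local Notation H := (affine uv).

(** The matrices [((u ^ j, 0), (a, 1))] represent the affine maps, but lose
    [j] if [u] has finite order; the scalar factor [2 ^ j] remembers it. *)
Lemma affine_linear (F : numFieldType) (f : {rmorphism A -> F}) :
  injective f -> linear_group H.
Proof.
move=> f_inj.
pose r (x : H) : 'M[F]_(1 + 1) :=
  2 ^ x.2 *: block_mx (f (pw x.2))%:M 0 (f x.1)%:M 1%:M.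
have rM x y : r (x * y)%g = r x *m r y.
  rewrite /r -scalemxAl -scalemxAr scalerA -expfzDr ?pnatr_eq0//.
  rewrite mulmx_block affineM /=.
  rewrite !(mulmx0, mul0mx, addr0, add0r, mulmx1, mul1mx).
  have -> : f (pw (x.2 + y.2)) = f (pw x.2) * f (pw y.2).
    by rewrite int_powD// rmorphM.
  have -> : f (x.1 * pw y.2 + y.1) = f x.1 * f (pw y.2) + f y.1.
    by rewrite rmorphD rmorphM.
  by rewrite scalar_mxM raddfD /= scalar_mxM.
have r1 : r 1%g = 1%:M.
  by rewrite /r /= expr0z scale1r rmorph1 raddf0 raddf0 -scalar_mx_block.
exists F, 2%N, r; split=> // [x|x y exy].
  have xV : r x *m r x^-1%g = 1%:M by rewrite -rM mulgV r1.
  by have [] := mulmx1_unit xV.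
have/matrixP/(_ (@rshift 1 1 0) (@rshift 1 1 0)) := exy.
rewrite mxE [in RHS]mxE !block_mxEdr !mxE /= !mulr1 => e2.
have exy2 : x.2 = y.2.
  have : 2 ^ (x.2 - y.2) == 1 :> F.
    by rewrite expfzDr ?pnatr_eq0// e2 -expfzDr ?pnatr_eq0// subrr.
  rewrite pexprz_eq1 ?ler0n// subr_eq0 => /orP[/eqP//|].
  by rewrite (eqr_nat F 2 1).
have/matrixP/(_ (@rshift 1 1 0) (@lshift 1 1 0)) := exy.
rewrite mxE [in RHS]mxE !block_mxEdl !mxE /= !mulr1n exy2.
move=> /(mulfI _) e1; rewrite [x]surjective_pairing [y]surjective_pairing exy2.
by rewrite (f_inj _ _ (e1 _)) // expfz_neq0// pnatr_eq0.
Qed.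

Definition int_mod (n : nat) (j : int) : 'I_n.+1 := inZp `|(j %% n.+1)%Z|%N.

Lemma int_mod_eq n i j : int_mod n i = int_mod n j <-> (n.+1 %| i - j)%Z.
Proof.
rewrite -eqz_mod_dvd.
split=> [/(congr1 val) /=|/eqP e]; last by rewrite /int_mod e.
have lt (k : int) : (`|(k %% n.+1)%Z| < n.+1)%N.
  by rewrite -ltz_nat gez0_abs ?modz_ge0// ltz_pmod.
rewrite !modn_small// => /(congr1 Posz).
by rewrite !gez0_abs ?modz_ge0// => ->.
Qed.

Lemma int_mod_surj n (i : 'I_n.+1) : int_mod n i = i.
Proof.
by apply: val_inj; rewrite /= modz_nat absz_nat modn_mod modn_small.
Qed.

(** If [f u] has order dividing [#|R|], then [f] extends to the quotient
    [R ><| Z/#|R|] of [H]. The elements with a nonzero integer component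
    survive in a cyclic quotient. *)
Lemma affine_residually (p : nat) : prime p ->
  (forall a : A, a != 0 ->
    exists (R : finComNzRingType) (f : {rmorphism A -> R}),
    [/\ p.-nat #|R|, forall c, exists a, f a = c, f u ^+ #|R| = 1
      & f a != 0]) ->
  residually p H.
Proof.
move=> p_pr resA; apply: residuallyP => -[a j] aj1.
have [a0|a0] := eqVneq a 0; last first.
  have [R [f [pR f_surj fu fa]]] := resA a a0.
  have [N NE] : exists N, #|R| = N.+1.
    by exists #|R|.-1; rewrite prednK//; case/andP: pR.
  pose h (x : H) := (f x.1, int_mod N x.2).
  have [||||M ME] := @congruence_pi_normal H _ h _ p.
  - move=> [c i]; have [b fb] := f_surj c.
    by exists (b, i%:Z); rewrite /h /= fb int_mod_surj.
  - move=> x y z /pair_equal_spec[fxy /int_mod_eq xy].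
    rewrite /h !affineM /= !rmorphD !rmorphM /= fxy.
    by congr pair; apply/int_mod_eq; rewrite opprD addrACA subrr addr0.
  - move=> x y z /pair_equal_spec[fxy /int_mod_eq xy].
    rewrite /h !affineM /= !rmorphD !rmorphM /= fxy.
    congr pair; last by apply/int_mod_eq; rewrite opprD addrACA subrr add0r.
    congr (_ * _ + _); have [w xyw] := dvdzP xy.
    rewrite (_ : x.2 = y.2 + N.+1%:Z * w); last first.
      by rewrite mulrC -xyw addrC subrK.
    by rewrite int_powD// rmorphM (int_pow_period uv) ?mulr1// -NE.
  - by rewrite card_prod card_ord -NE pnatM pR.
  by exists M => /ME[fa0 _]; move: fa; rewrite fa0 /= raddf0 eqxx.
have j0 : j != 0 by apply: contra_not_neq aj1 => ->; rewrite a0.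
pose N := (p ^ `|j|).-1.
have NE : N.+1 = (p ^ `|j|)%N by rewrite prednK// expn_gt0 prime_gt0.
pose h (x : H) := int_mod N x.2.
have [||||M ME] := @congruence_pi_normal H _ h _ p.
- by move=> i; exists (0, i%:Z); rewrite /h /= int_mod_surj.
- move=> x y z /int_mod_eq xy; apply/int_mod_eq; rewrite !affineM /=.
  by rewrite opprD addrACA subrr addr0.
- move=> x y z /int_mod_eq xy; apply/int_mod_eq; rewrite !affineM /=.
  by rewrite opprD addrACA subrr add0r.
- by rewrite card_ord NE pnatX pnat_id.
exists M => /ME/int_mod_eq; rewrite subr0 NE dvdzE absz_nat => /dvdn_leq.
by rewrite -[(a, j).2]/j absz_gt0 j0 leqNgt ltn_expl ?prime_gt1// => /(_ isT).
Qed.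

End AffineProperties.

Section AffineSubgroup.
Import GRing.Theory Num.Theory.
Local Open Scope ring_scope.
Local Open Scope classical_set_scope.
Variables (A : comNzRingType) (u v : A) (uv : u * v = 1) (d : nat).
Local Notation pw := (int_pow u v).
Local Notation H := (affine uv).
Hypothesis d_gt0 : (0 < d)%N.

Fact rot_subgroup_closed : is_subgroup [set x : H | (d %| x.2)%Z].
Proof.
split=> [|x y /set_mem/= dx /set_mem/= dy]; apply/mem_set => //=.
by rewrite rpredB.
Qed.

Definition rot_subgroup : subgroup H := Subgroup rot_subgroup_closed.
Local Notation K := rot_subgroup.

Lemma rot_subgroup_index : has_index (sg_set K) d.
Proof.
pose h (x : H) := int_mod d.-1 x.2.
have : has_index (sg_set K) #|'I_d.-1.+1|.
  apply: (@has_index_fin _ _ h) => [i|x y].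
    by exists (0, i%:Z); rewrite /h /= int_mod_surj.
  by rewrite /h int_mod_eq prednK//= -opprB rpredN addrC.
by rewrite card_ord prednK.
Qed.

Definition rot_exponent (x : H) : nat := `|(x.2 %% d)%Z|%N.

Lemma rot_exponentM x y :
  rot_exponent (x * y)%g = (rot_exponent x + rot_exponent y)%N %[mod d].
Proof.
have d0 : d%:Z != 0 by rewrite eqz_nat -lt0n.
suff : (rot_exponent (x * y)%g =
    (rot_exponent x + rot_exponent y)%N %[mod d])%Z.
  by rewrite !modz_nat => -[].
by rewrite PoszD /rot_exponent !gez0_abs ?modz_ge0// modz_mod modzDm.
Qed.

Lemma rot_exponentK x : sg_set K x <-> (d %| rot_exponent x)%N.
Proof.
have d0 : d%:Z != 0 by rewrite eqz_nat -lt0n.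
rewrite /= -[(d %| rot_exponent x)%N]/(d%:Z %| (rot_exponent x)%:Z)%Z.
rewrite /rot_exponent gez0_abs ?modz_ge0//.
by split=> /dvdz_mod0P e; apply/dvdz_mod0P; rewrite modz_mod in e *.
Qed.

(** The quotient by [N] has order a power of [p], hence [N] contains the [n]-th
    powers of rotations for some [n] prime to [d]; these correct the integer
    component modulo [d]. *)
Lemma rot_subgroup_dense (p : nat) (N : pi_normal p H) x :
  prime p -> coprime d p ->
  exists2 y, sg_set K y & sg_set N (x^-1 * y)%g.
Proof.
move=> p_pr cdp; have [n pn nN] := pi_normal_expg N.
have cdn : coprime d n by have [e ->] := p_natP pn; rewrite coprimeXr.
have [a [b ab]] := Bezoutz d n.
have {}ab : a * d%:Z + b * n%:Z = 1 by rewrite ab /gcdz /= (eqP cdn).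
pose r z := rotation uv (n%:Z * z).
have Nr z : sg_set N (r z).
  apply: (@int_hom_gen H r z _ N) => [i j|].
    by rewrite /r mulrDr rotationD.
  split=> [|_ ->]; first exact: sg_closed.
  have := nN (rotation uv 1); rewrite rotationX /r mulr1.
  by rewrite -[X in X -> _]/(sg_set N (rotation uv n%:R)) natz.
exists (x * r (- (x.2 * b)))%g; last by rewrite mulKg.
rewrite /= mulrN mulrCA [n%:Z * b]mulrC -{1}[x.2]mulr1 -ab mulrDr addrK.
by rewrite mulrA dvdz_mull.
Qed.

Section Generation.
Variables (n : nat) (x : 'I_n -> A).
Hypothesis xA : forall a, exists c : 'I_n -> int, a = \sum_i x i *~ c i.

Lemma affine_bounded : boundedly_generated H.
Proof.
apply: (abelian_by_cyclic_bounded xA (@translationD _ _ _ uv)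
  (@rotationD _ _ _ uv)) => g.
by exists g.2, g.1; apply: affine_split.
Qed.

Lemma rot_subgroup_bounded : boundedly_generated K.
Proof.
have Kt a : translation uv a \in sg_set K by apply/mem_set; apply: dvdz0.
have Kr z : rotation uv (d%:Z * z) \in sg_set K.
  by apply/mem_set; rewrite /= dvdz_mulr.
apply: (@abelian_by_cyclic_bounded _ _ _ xA K (fun a => SigSub (Kt a))
  (fun z => SigSub (Kr z))) => [a b|i j|g].
- exact/val_inj/translationD.
- by apply/val_inj; rewrite /= mulrDr rotationD.
- have /dvdzP[z gz] : (d %| (val g).2)%Z by apply: (set_mem (valP g)).
  exists z, (val g).1; apply/val_inj.
  by rewrite /= [LHS]affine_split gz mulrC.
Qed.

End Generation.

End AffineSubgroup.

Section CompletionNotInjective.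
Import GRing.Theory Num.Theory.
Local Open Scope ring_scope.
Local Open Scope classical_set_scope.
Variables (A : comNzRingType) (u v : A) (uv : u * v = 1) (p d : nat).
Local Notation pw := (int_pow u v).
Local Notation H := (affine uv).
Local Notation K := (rot_subgroup uv d).
Variables (R : finZmodType) (f : {additive A -> R}).
Hypothesis f_surj : forall c, exists a, f a = c.
Hypothesis pR : p.-nat #|R|.
Hypothesis f_fix : forall a, f (a * u ^+ d) = f a.
Hypothesis f_move : forall n, p.-nat n -> f (u ^+ n) != f 1.

Let f_fix_pow a z : f (a * pw (d%:Z * z)) = f a.
Proof.
have fu b n : f (b * u ^+ (d * n)%N) = f b.
  elim: n => [|n IH]; first by rewrite muln0 expr0 mulr1.
  by rewrite mulnS exprD mulrA mulrAC f_fix IH.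
have [m [n ->]] := int_diff z.
rewrite mulrBr -!PoszM int_powB// mulrA -[LHS](fu _ n) -mulrA -exprMn.
by rewrite [v * u]mulrC uv expr1n mulr1 fu.
Qed.

(** The translations in the kernel of [f] and the rotations form an open
    subgroup of [K], as [u ^+ d] acts trivially through [f]. If a power [n] of
    [p] annihilates a quotient of [H], then translation by [1 - u ^+ n], a
    commutator with an [n]-th power, dies there, but not under [f]. *)
Lemma rot_completion_not_inj :
  ~ injective (@completion_map p K H (@sg_incl H K)).
Proof.
pose h (x : K) := f (val x).1.
have tK a : translation uv a \in sg_set K by apply/mem_set; apply: dvdz0.
have [|||M ME] := @congruence_pi_normal K R h _ p _ _ pR.
- by move=> c; have [a fa] := f_surj c; exists (SigSub (tK a)).
- move=> x y z xy; rewrite /h /= !raddfD /=.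
  have /dvdzP[w ->] : (d %| (val z).2)%Z by apply: (set_mem (valP z)).
  by rewrite [w * _]mulrC !f_fix_pow; congr (_ + _).
- move=> x y z xy; rewrite /h /= !raddfD /=.
  have /dvdzP[w ->] : (d %| (val x).2)%Z by apply: (set_mem (valP x)).
  have /dvdzP[w' ->] : (d %| (val y).2)%Z by apply: (set_mem (valP y)).
  by rewrite [w * _]mulrC [w' * _]mulrC !f_fix_pow; congr (_ + _).
apply: (completion_map_not_inj (M := M)) => N.
have [n pn nN] := pi_normal_expg N.
exists (SigSub (tK (1 - u ^+ n))) => /=; last first.
  move/ME; rewrite /h /= raddfB raddf0 => /eqP.
  by rewrite subr_eq0 eq_sym; apply/negP/f_move.
have Nr := nN (rotation uv 1); rewrite rotationX in Nr.
rewrite (_ : translation uv (1 - u ^+ n) =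
  ((rotation uv (1 *+ n))^-1 * rotation uv (1 *+ n) ^ translation uv 1)%g).
  exact: sgM (sgV Nr) (ns_normal (translation uv 1) Nr).
rewrite conjgE !affineM !affineV /= natz !(mul0r, oppr0, add0r, addr0) /=.
by rewrite addNr mulr1 mulN1r addrC.
Qed.

End CompletionNotInjective.

(** * Amalgamated doubles *)

Section AmalgamTheory.
Variables (A B C : groupType).
Variables (i : {multiplicative C -> A}) (j : {multiplicative C -> B}).
Local Notation Gamma := (amalgam i j).
Local Notation inA := (@amalg_inl A B C i j).
Local Notation inB := (@amalg_inr A B C i j).

Lemma amalg_inl_morph : {morph inA : x y / x * y}.
Proof.
move=> x y; rewrite -[RHS]/(amalg_mul _ _) amalg_mulE.
exact/amalg_wordP/amalg_sym/amalg_inlM.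
Qed.

Lemma amalg_inr_morph : {morph inB : x y / x * y}.
Proof.
move=> x y; rewrite -[RHS]/(amalg_mul _ _) amalg_mulE.
exact/amalg_wordP/amalg_sym/amalg_inrM.
Qed.

HB.instance Definition _ := isMultiplicative.Build A Gamma inA amalg_inl_morph.
HB.instance Definition _ := isMultiplicative.Build B Gamma inB amalg_inr_morph.

Lemma amalg_ind (P : Gamma -> Prop) :
  P 1 -> (forall x g, P g -> P (inA x * g)) ->
  (forall y g, P g -> P (inB y * g)) -> forall g, P g.
Proof.
move=> P1 PA PB g; have [w ->] := amalg_surj g; elim: w => [|[x|y] w Pw] //.
  by rewrite -cat1s -amalg_mulE; apply: PA.
by rewrite -cat1s -amalg_mulE; apply: PB.
Qed.

Lemma amalg_hom (T : groupType) (f : {multiplicative A -> T})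
    (g : {multiplicative B -> T}) : (forall c, f (i c) = g (j c)) ->
  exists h : {multiplicative Gamma -> T},
    (forall x, h (inA x) = f x) /\ (forall y, h (inB y) = g y).
Proof.
move=> fg; have [h [[hM hA hB] _]] := amalg_universal fg.
pose m := isMultiplicative.Build Gamma T h hM.
by exists (HB.pack_for {multiplicative Gamma -> T} h m).
Qed.

Lemma amalg_finitely_generated :
  finitely_generated A -> finitely_generated B -> finitely_generated Gamma.
Proof.
case=> [S Sfin SA] [T Tfin TB]; exists (inA @` S `|` inB @` T).
  by rewrite finite_setU; split; apply: finite_image.
pose K := Subgroup (gen_is_subgroup (inA @` S `|` inB @` T)).
apply/seteqP; split=> // g _; rewrite -[gen _]/(sg_set K).
elim/amalg_ind: g => [|x g Kg|y g Kg]; first exact: sg1.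
  apply: sgM Kg; apply: (@gen_mono _ (inA @` S)) => [z|]; first by left.
  by apply: gmulf_gen; rewrite SA.
apply: sgM Kg; apply: (@gen_mono _ (inB @` T)) => [z|]; first by right.
by apply: gmulf_gen; rewrite TB.
Qed.

End AmalgamTheory.

(** Two homomorphisms that are inverse to each other modulo every open normal
    subgroup induce inverse maps on the completions. *)
Lemma completion_mapK (pi : nat_pred) (G H : groupType)
    (a : {multiplicative G -> H}) (b : {multiplicative H -> G}) :
  (forall (N : pi_normal pi H) y, sg_set N (y^-1 * a (b y))) ->
  cancel (@completion_map pi H G b) (@completion_map pi G H a).
Proof.
move=> abN y; apply: completion_eq => N.
pose P := preim_pn b (preim_pn a N).
have [h yh] := completion_coset y P.
rewrite (completion_map_coord (completion_map_coord yh)).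
have s z : sg_set P z -> sg_set N (idfun z).
  by move=> /= Nz; have := sgM Nz (sgV (abN N z)); rewrite invgM invgK mulVKg.
rewrite -(set_mem (valP y) _ _ s) yh quot_mapE.
by apply/esym/coset_eq; apply: abN.
Qed.

Section Double.
Variables (H : groupType) (K : subgroup H).
Local Notation Gamma := (amalgam_double K).
Local Notation inl_ := (@amalg_inl H H K (@sg_incl H K) (@sg_incl H K)).
Local Notation inr_ := (@amalg_inr H H K (@sg_incl H K) (@sg_incl H K)).

Lemma double_inl_inr k : sg_set K k -> inl_ k = inr_ k.
Proof. by move=> Kk; apply: (amalg_inl_inr _ _ (SigSub (mem_set Kk) : K)). Qed.

Lemma double_fold : exists h : {multiplicative Gamma -> H},
  (forall x, h (inl_ x) = x) /\ (forall x, h (inr_ x) = x).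
Proof. exact: (@amalg_hom _ _ _ _ _ H idfun idfun). Qed.

Section Dense.
Variable pi : nat_pred.
Hypothesis dK : forall (N : pi_normal pi H) (x : H),
  exists2 y, sg_set K y & sg_set N (x^-1 * y).
Variable fold : {multiplicative Gamma -> H}.
Hypothesis foldl_ : forall x, fold (inl_ x) = x.
Hypothesis foldr_ : forall x, fold (inr_ x) = x.

(** Modulo [M] the two copies of [x] are equal, because [x] can be replaced
    by an element of [K] that is congruent to it in both copies of [H]. *)
Lemma double_fold_mod (M : pi_normal pi Gamma) g :
  sg_set M (g^-1 * inl_ (fold g)).
Proof.
apply/coset_eq; elim/amalg_ind: g => [|x g IH|x g IH]; first by rewrite !mulf1.
  by rewrite !gmulfM foldl_ !cosetM -IH.
rewrite !gmulfM foldr_ !cosetM -IH; congr (_ * _).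
have [k Kk [/= kl kr]] := dK (cap_pn (preim_pn inl_ M) (preim_pn inr_ M)) x.
apply: (@etrans _ _ (coset M (inr_ k))); first apply/coset_eq.
  by move: kr; rewrite gmulfM mulfV.
apply/esym; rewrite -double_inl_inr //; apply/coset_eq.
by move: kl; rewrite gmulfM mulfV.
Qed.

Lemma double_completion_iso :
  top_isomorphic (completion pi Gamma) (completion pi H).
Proof.
exists (@completion_map pi Gamma H fold), (@completion_map pi H Gamma inl_).
split.
- exact: completion_mapM.
- exact/completion_mapK/double_fold_mod.
- by apply: completion_mapK => N y; rewrite foldl_ mulVg; apply: sg1.
- exact: completion_map_continuous.
- exact: completion_map_continuous.
Qed.

Lemma double_inl_completion g :
  to_completion pi (inl_ (fold g)) = to_completion pi g.
Proof.
by apply: completion_eq => N; apply/esym/coset_eq/double_fold_mod.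
Qed.

Lemma double_completion_bounded :
  boundedly_generated H -> top_boundedly_generated (completion pi Gamma).
Proof.
apply: (@completion_boundedly_generated pi H Gamma inl_) => g.
by exists (fold g); apply: double_inl_completion.
Qed.

Lemma double_not_residually x :
  inl_ x <> inr_ x -> ~ residually pi Gamma.
Proof.
move=> lr res; apply: lr; apply: res.
by rewrite -[RHS]double_inl_completion foldr_.
Qed.

End Dense.

Section Words.

Definition side (s : bool) (x : H) : Gamma := if s then inl_ x else inr_ x.

Lemma sideM s : {morph side s : x y / x * y}.
Proof. by case: s => x y; rewrite /side gmulfM. Qed.

Lemma side1 s : side s 1 = 1.
Proof. by case: s; rewrite /side mulf1. Qed.

Lemma side_eq s s' k : sg_set K k -> side s k = side s' k.
Proof. by move=> Kk; case: s s' => -[] //; rewrite /side double_inl_inr. Qed.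

Fixpoint alternating (s : bool) (w : seq H) : Gamma :=
  if w is x :: w' then side s x * alternating (~~ s) w' else 1.

Definition reduced (w : seq H) := forall x, x \in w -> ~ sg_set K x.

(** A new letter absorbs the factor in [K] in front of the word, then is either
    itself in [K], or starts a longer word, or merges with the first letter. *)
Lemma double_normal_form (g : Gamma) : exists k s w,
  [/\ sg_set K k, reduced w & g = side s k * alternating s w].
Proof.
suff Pl s0 x g' : (exists k s w,
    [/\ sg_set K k, reduced w & g' = side s k * alternating s w]) ->
  exists k s w,
    [/\ sg_set K k, reduced w & side s0 x * g' = side s k * alternating s w].
  elim/amalg_ind: g => [|x g|x g]; [|exact: (Pl true)|exact: (Pl false)].
  by exists 1, true, [::]; split=> //; [apply: sg1|rewrite side1 mulg1].
case=> k [s [w [Kk rw ->]]].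
rewrite (side_eq _ s0)// mulgA -sideM; move: (x * k) => {}x {k Kk}.
have [Kx|nKx] := pselect (sg_set K x).
  by exists x, s, w; split=> //; rewrite (side_eq _ s).
have [->|ss0] := eqVneq s s0; last first.
  exists 1, s0, (x :: w); split; first exact: sg1.
    by move=> y; rewrite inE => /orP[/eqP->//|]; apply: rw.
  by rewrite side1 mul1g /=; case: (s0) s ss0 => -[].
case: w rw => [|y w] rw /=.
  exists 1, s0, [:: x]; split; first exact: sg1.
    by move=> y; rewrite inE => /eqP->.
  by rewrite side1 mul1g.
rewrite mulgA -sideM; have rw' : reduced w.
  by move=> z zw; apply: rw; rewrite inE zw orbT.
have [Kxy|nKxy] := pselect (sg_set K (x * y)).
  by exists (x * y), (~~ s0), w; split=> //; rewrite (side_eq _ (~~ s0)).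
exists 1, s0, (x * y :: w); split; first exact: sg1.
  by move=> z; rewrite inE => /orP[/eqP->//|]; apply: rw'.
by rewrite side1 mul1g.
Qed.

End Words.

Section Exponent.
Variables (m : nat) (e : H -> nat).
Hypothesis eM : forall x y, e (x * y) = e x + e y %[mod m].
Hypothesis eK : forall x, sg_set K x <-> (m %| e x)%N.

Lemma double_hom (T : groupType) (x y : T) : x ^+ m = 1 -> y ^+ m = 1 ->
  exists h : {multiplicative Gamma -> T},
    (forall a, h (inl_ a) = x ^+ e a) /\ (forall a, h (inr_ a) = y ^+ e a).
Proof.
have hm (z : T) : z ^+ m = 1 ->
    exists f : {multiplicative H -> T}, forall a, f a = z ^+ e a.
  move=> zm.
  have fM : {morph (fun a => z ^+ e a) : a b / a * b}.
    by move=> a b; rewrite -expgnDr -(expg_modn _ zm) eM expg_modn.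
  pose mx := isMultiplicative.Build H T _ fM.
  by exists (HB.pack_for {multiplicative H -> T} (fun a => z ^+ e a) mx).
move=> xm ym; have [f fE] := hm x xm; have [g gE] := hm y ym.
have [|h [hl hr]] := @amalg_hom _ _ _ (@sg_incl H K) (@sg_incl H K) T f g.
  move=> c; rewrite fE gE.
  have /eK/dvdnP[n ->] : sg_set K (sg_incl c) by apply/set_mem/valP.
  by rewrite mulnC !expgnA xm ym !expg1n.
by exists h; split=> a; rewrite ?hl ?hr.
Qed.

End Exponent.
End Double.

(** * Finite quotients of doubles *)

Section Steps.
Import GRing.Theory.
Variables (r m : nat).
Local Notation state := {ffun 'I_r.+1 -> 'I_m.+1}.
Implicit Types (g : state) (j : 'I_r.+1) (n : nat).
Local Open Scope ring_scope.

Definition active (b : bool) g j : bool :=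
  (odd j == b) && ((j == 0 :> nat)%N || (g (inord j.-1) != 0)).

(** A reduced word of length [r + 1] in [Z/(m+1) * Z/(m+1)] is read on vectors
    indexed by its positions. A generator of one factor acts on the positions
    of one parity, adding 1 where the preceding coordinate is nonzero (and at
    position 0). As the condition concerns the other parity only, this is a
    permutation of order dividing [m + 1]. *)
Definition step b n g : state :=
  [ffun j => g j + (if active b g j then inZp n else 0)].

Lemma inZpD n n' : inZp (n + n') = inZp n + inZp n' :> 'I_m.+1.
Proof. by apply: val_inj; rewrite /= modnDm. Qed.

Lemma active_step b n g j : active b (step b n g) j = active b g j.
Proof.
rewrite /active; case: eqP => //= jb; case: (posnP j) => //= j0.
rewrite ffunE /active inordK; last by rewrite (leq_ltn_trans (leq_pred _)).
have -> : odd j.-1 = ~~ b by rewrite -jb -[in RHS](prednK j0) /= negbK.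
by case: (b); rewrite /= addr0.
Qed.

Lemma stepD b n n' g : step b n (step b n' g) = step b (n + n') g.
Proof.
apply/ffunP => j; rewrite !ffunE active_step.
case: ifP => _; last by rewrite !addr0.
by rewrite inZpD [inZp n + _]addrC addrA.
Qed.

Lemma step_dvd b n g : (m.+1 %| n)%N -> step b n g = g.
Proof.
move=> mn; apply/ffunP => j; rewrite ffunE.
have -> : inZp n = 0 :> 'I_m.+1 by apply: val_inj; apply/eqP.
by rewrite if_same addr0.
Qed.

Lemma step_inj b : injective (step b 1).
Proof.
by apply: (@can_inj _ _ _ (step b m)) => g; rewrite stepD addn1 step_dvd.
Qed.

(** The first [i] letters have been read. *)
Definition front i g :=
  (forall j, (i <= j)%N -> g j = 0) /\ (forall j, j.+1 = i -> g j != 0).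

(** Reading a letter [n] moves the front by one place: the coordinate at [i]
    becomes [n], which is not zero, and the ones after it are not reached. *)
Lemma front_step i n g : (i <= r)%N -> ~~ (m.+1 %| n)%N -> front i g ->
  front i.+1 (step (odd i) n g).
Proof.
move=> ir mn [g0 g1]; split=> [j ij|j [ji]].
  rewrite ffunE g0 ?(ltnW ij)// add0r /active; case: ifP => // /andP[_].
  rewrite (gtn_eqF (leq_ltn_trans (leq0n i) ij)) /= g0 ?eqxx //.
  rewrite inordK; last by rewrite (leq_ltn_trans (leq_pred _)).
  by rewrite -ltnS prednK // (leq_ltn_trans _ ij).
rewrite ffunE g0 ?ji// add0r /active ji eqxx /=; case: ifP => [_|].
  by apply: contra mn => /eqP/(congr1 val) /= e; apply/eqP.
case: (posnP i) => //= i0 /negbT/negP[]; apply: g1.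
by rewrite inordK prednK // ltnW.
Qed.

End Steps.

Section StepPerm.
Import fingroup perm.
Variables (r m : nat).
Local Notation state := {ffun 'I_r.+1 -> 'I_m.+1}.

Definition step_perm b : {perm state} := perm (@step_inj r m b).

Lemma step_permX b n g : (step_perm b ^+ n) g = step b n g.
Proof.
rewrite permX; elim: n => [|n IH]; first by rewrite step_dvd.
by rewrite iterS IH permE stepD add1n.
Qed.

Lemma step_perm_order b : step_perm b ^+ m.+1 = 1.
Proof. by apply/permP => g; rewrite step_permX step_dvd// perm1. Qed.

End StepPerm.

Section DoubleFinite.
Import fingroup perm.
Variables (H : groupType) (K : subgroup H).
Local Notation Gamma := (amalgam_double K).
Local Notation inl_ := (@amalg_inl H H K (@sg_incl H K) (@sg_incl H K)).
Local Notation inr_ := (@amalg_inr H H K (@sg_incl H K) (@sg_incl H K)).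

(** Starting from the zero vector, the front moves by one place for each
    letter, so that the last coordinate of the final vector is not zero. *)
Lemma alternating_moves (m : nat) (e : H -> nat) s (w : seq H) : (0 < m)%N ->
  (forall x y, e (x * y) = e x + e y %[mod m]) ->
  (forall x, sg_set K x <-> (m %| e x)%N) -> w != [::] -> reduced K w ->
  exists (T : finGroupType) (f : {multiplicative Gamma -> T}),
    forall k, sg_set K k -> f (side K s k * alternating K s w) <> 1.
Proof.
case: m => // m _ eM eK; case: w => // x0 w0; set w := x0 :: w0 => _ rw.
pose r := size w0; pose T := {perm {ffun 'I_r.+1 -> 'I_m.+1}}.
pose sp b : T := step_perm r m b.
have [f [fl fr]] := @double_hom H K m.+1 e eM eK T (sp (~~ s)) (sp s)
  (step_perm_order _ _ _) (step_perm_order _ _ _).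
have fside s' x : f (side K s' x) = sp (s (+) s') ^+ e x.
  by case: s' => /=; rewrite ?fl ?fr ?addbT ?addbF.
exists T, f => k Kk fk1.
have walk i (g : {ffun 'I_r.+1 -> 'I_m.+1}) v : reduced K v ->
    (i + size v <= r.+1)%N -> front i g ->
    front (i + size v) ((f (alternating K (s (+) odd i) v) : T) g).
  elim: v i g => [|x v IH] i g rv iv gi /=.
    by rewrite mulf1 perm1 addn0.
  have ir : (i <= r)%N by rewrite -ltnS (leq_trans _ iv)//= addnS ltnS leq_addr.
  rewrite gmulfM fside addbA addbb addFb permM step_permX.
  have -> : ~~ (s (+) odd i) = s (+) odd i.+1 by rewrite addbN.
  rewrite -addSnnS; apply: IH.
  - by move=> y yv; apply: rv; rewrite inE yv orbT.
  - by rewrite addSnnS.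
  - apply: front_step => //; apply/negP => /eK; apply: rv.
    exact: mem_head.
have f0 : front 0 ([ffun=> 0%R] : {ffun 'I_r.+1 -> 'I_m.+1}).
  by split=> // j _; rewrite ffunE.
have := walk 0%N _ w rw (leqnn _) f0; rewrite addbF => -[_ /(_ ord_max erefl)].
move: fk1; rewrite gmulfM fside addbb.
have -> : sp false ^+ e k = 1.
  have /eK/dvdnP[n ->] := Kk.
  by rewrite mulnC expgnA step_perm_order expg1n.
rewrite mul1g => ->.
by rewrite perm1 ffunE eqxx.
Qed.

Variables (m : nat) (e : H -> nat).
Hypothesis m_gt0 : (0 < m)%N.
Hypothesis eM : forall x y, e (x * y) = e x + e y %[mod m].
Hypothesis eK : forall x, sg_set K x <-> (m %| e x)%N.

Lemma double_inl_neq_inr x : ~ sg_set K x -> inl_ x <> inr_ x.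
Proof.
move=> nKx lr; have rw : reduced K [:: x; x^-1].
  move=> y; rewrite !inE => /orP[]/eqP->//.
  by move=> /sgV; rewrite invgK.
have [T [f /(_ 1 (sg1 K))]] :=
  @alternating_moves m e true [:: x; x^-1] m_gt0 eM eK isT rw.
by case; rewrite side1 mul1g /= mulg1 /side lr -gmulfM mulgV !mulf1.
Qed.

Lemma double_residually_finite : residually predT H -> residually predT Gamma.
Proof.
move=> resH; apply: residuallyP => g g1.
have [k [s [w [Kk rw gE]]]] := double_normal_form g.
have [w0|w0] := eqVneq w [::].
  have [fold [foldl_ foldr_]] := double_fold K.
  have gk : fold g = k.
    by rewrite gE w0 mulg1 /side; case: (s); rewrite ?foldl_ ?foldr_.
  apply: contrapT => /forallNP gN; apply: g1; rewrite gE w0 mulg1.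
  rewrite (residually_eq1 resH (x := k)) ?side1// => N.
  by have /contrapT /= := gN (preim_pn fold N); rewrite gk.
have [T [f fP]] := alternating_moves s m_gt0 eM eK w0 rw.
have [N NE] := trivial_pi_normal (finGroup_predT T).
exists (preim_pn f N) => /= /NE; rewrite gE; exact: fP.
Qed.

End DoubleFinite.

Section BoundedGenerationObstruction.
Import fingroup cyclic.
(** The images of the [d] procyclic factors in [W] are cyclic of order at
    most [n]. *)
Lemma bounded_completion_card (pi : nat_pred) (G : groupType) :
  top_boundedly_generated (completion pi G) ->
  exists d, forall (W : finGroupType) (f : {multiplicative G -> W}) n
    (A : {set W}),
    pi.-nat #|W| -> 0 < n -> (forall w : W, w ^+ n = 1) ->
    (forall w, w \in A -> exists g, f g = w) -> #|A| <= n ^ d.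
Proof.
case=> gs gsT; exists (size gs) => W f n A piW n0 Wn Af.
have [N NE] := trivial_pi_normal piW.
have [|h [hf hcl]] := @completion_descent pi G W f (preim_pn f N) _ .
  by move=> x /=; apply: NE.
pose P := (\prod_(c <- gs) <[h c]>)%g.
have hP y : (\big[@setM (completion pi G)/[set 1]]_(c <- gs)
    closure (gen [set c])) y -> h y \in P.
  rewrite /P; elim: gs y {gsT P} => [|c cs IH] y.
    by rewrite !big_nil => ->; rewrite inE; apply/eqP/(mulf1 h).
  rewrite !big_cons => -[u cu [v cv <-]]; rewrite gmulfM.
  apply: mem_mulg; last exact: IH.
  have [z gz <-] := hcl _ _ cu; pose Z := <[h c]>%g.
  apply: (gz [set t | h t \in Z]).
  split=> [|_ ->]; last exact: cycle_id.
  split; first by apply/mem_set; rewrite /= (mulf1 h) group1.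
  move=> t t' /set_mem/= ht /set_mem/= ht'; apply/mem_set => /=.
  by rewrite gmulfM (mulfV h) groupM ?groupV.
apply: (@leq_trans #|P|).
  apply: subset_leq_card; apply/fintype.subsetP => w /Af[g <-].
  by rewrite -hf; apply: hP; rewrite gsT.
rewrite /P; elim: (gs) => [|c cs IH]; first by rewrite big_nil cards1.
rewrite big_cons expnS; apply: leq_trans (card_mulg_leq _ _) _.
apply: leq_mul IH; apply: dvdn_leq => //.
by rewrite -[#|_|]/#[h c] order_dvdn Wn.
Qed.

Lemma double_not_bounded (H : groupType) (K : subgroup H) (m : nat)
    (e : H -> nat) (t : H) :
  (forall x y, e (x * y) = e x + e y %[mod m]) ->
  (forall x, sg_set K x <-> (m %| e x)%N) -> e t = 1 %[mod m] -> (4 < m)%N ->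
  ~ top_boundedly_generated (profinite_completion (amalgam_double K)).
Proof.
move=> eM eK et m4 /bounded_completion_card[d dP].
have [W [x [y [n [xm ym Wn n0 big]]]]] := finite_groups_not_bounded d m4.
have [f [fl fr]] := @double_hom H K m e eM eK W x y xm ym.
suff Qf w : w \in <<[set x; y]%SET>>%g -> exists g, f g = w.
  by have := dP W f n _ (finGroup_predT W) n0 Wn Qf; rewrite leqNgt big.
pose Im : {set W} := [set v : W | `[< exists g, f g = v >]]%SET.
have gIm : group_set Im.
  apply/group_setP; split.
    by rewrite inE; apply/asboolP; exists 1; apply: mulf1.
  move=> u v; rewrite !inE => /asboolP[a <-] /asboolP[b <-].
  by apply/asboolP; exists (a * b); apply: gmulfM.
suff Qs : <<[set x; y]%SET>>%g \subset group gIm.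
  by move/(fintype.subsetP Qs); rewrite inE => /asboolP.
have te (v : W) : v ^+ m = 1 -> v ^+ e t = v.
  by move=> vm; rewrite -(expg_modn _ vm) et expg_modn.
rewrite gen_subG; apply/fintype.subsetP => v; rewrite !inE.
case/orP => /eqP->; apply/asboolP.
  by exists (amalg_inl _ _ t); rewrite fl te.
by exists (amalg_inr _ _ t); rewrite fr te.
Qed.

End BoundedGenerationObstruction.

(** * The groups H and K *)

Lemma linear_subgroup (G : groupType) (K : subgroup G) :
  linear_group G -> linear_group K.
Proof.
case=> F [n [r [ru rM r_inj]]]; exists F, n, (r \o val); split=> [x|x y|x y].
- exact: ru.
- exact: rM.
- by move/r_inj/val_inj.
Qed.

Lemma residually_subgroup (pi : nat_pred) (G : groupType) (K : subgroup G) :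
  residually pi G -> residually pi K.
Proof.
move=> resG; apply: residuallyP => k k1; apply: contrapT => /forallNP kN.
apply: k1; apply/val_inj; apply: (residually_eq1 resG) => N.
by have /contrapT := kN (preim_pn (@sg_incl G K) N).
Qed.

Lemma residually_finite_of_p (p : nat) (G : groupType) :
  residually p G -> residually predT G.
Proof.
move=> resG; apply: residuallyP => x x1; apply: contrapT => /forallNP xN.
apply: x1; apply: (residually_eq1 resG) => N.
have Nfin : exists2 n, predT.-nat n & has_index (sg_set N) n.
  have [n /andP[n0 _] Nn] := pn_index N; exists n => //.
  by rewrite /pnat n0; apply/allP.
by have /contrapT := xN (PiNormal Nfin).
Qed.

Theorem theorem3 (p : nat) (p_prime : prime p) :
  exists (H : groupType) (K : subgroup H),
    let Gamma := amalgam_double K in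
    let phi := @completion_map p K H (@sg_incl H K) in
    [/\ [/\ finitely_generated H, linear_group H, residually p H
           & boundedly_generated H],
        [/\ finitely_generated K, linear_group K, residually p K
           & boundedly_generated K],
        [/\ exists2 m : nat, has_index (sg_set K) m & coprime m p,
            dense (sg_set K : set (pro_topology p H)),
            forall y : completion p H, exists x : completion p K, phi x = y
          & ~ injective phi]
      & [/\ finitely_generated Gamma,
            residually_finite Gamma /\ ~ residually p Gamma,
            top_isomorphic (completion p Gamma) (completion p H),
            top_boundedly_generated (completion p Gamma)
          & ~ top_boundedly_generated (profinite_completion Gamma)]].
Proof.
have [q q_gt q_pr] := prime_above (p + 5).
have pq : coprime p q.
  rewrite prime_coprime// dvdn_prime2//; apply/eqP => pq.
  by move: q_gt; rewrite -pq ltnNge leq_addr.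
have uv := ring_uv p q_pr.
pose H := affine uv; pose K := rot_subgroup uv q.
have q0 := prime_gt0 q_pr.
have Hbg : boundedly_generated H :=
  affine_bounded uv (ring_span (p := p) q_pr).
have Kbg : boundedly_generated K :=
  rot_subgroup_bounded uv q (ring_span (p := p) q_pr).
have [F [f f_inj]] := ring_embeds q_pr pq.
have Hlin : linear_group H := affine_linear uv f_inj.
have Hres : residually p H :=
  affine_residually p_prime (ring_residual p_prime q_pr pq).
have qp : coprime q p by rewrite coprime_sym.
have dK (N : pi_normal p H) x := rot_subgroup_dense N x p_prime qp.
have eM := @rot_exponentM _ _ _ uv q q0.
have eK := @rot_exponentK _ _ _ uv q q0.
have not_inj : ~ injective (@completion_map p K H (@sg_incl H K)).
  have cR : p.-nat #|{: 'rV['F_p]_q}|.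
    by rewrite card_mx card_Fp// mul1n pnatX pnat_id.
  exact: (@rot_completion_not_inj _ _ _ uv p q 'rV['F_p]_q (@coef_mod p q)
    (coef_mod_surj q_pr) cR (coef_mod_fix p_prime q_pr)
    (coef_mod_move p_prime q_pr pq)).
have [fold [foldl_ foldr_]] := double_fold K.
exists H, K; split; split.
- exact: bounded_finitely_generated.
- by [].
- by [].
- by [].
- exact: bounded_finitely_generated.
- exact: linear_subgroup.
- exact: residually_subgroup.
- by [].
- by exists q => //; apply: rot_subgroup_index.
- exact: dense_pro_topology.
- exact: dense_completion_surj.
- exact: not_inj.
- by apply: amalg_finitely_generated; apply: bounded_finitely_generated.
- split.
    apply: (double_residually_finite q0 eM eK).
    exact: residually_finite_of_p Hres.
  apply: (double_not_residually dK foldl_ foldr_ (x := rotation uv 1)).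
  apply: (double_inl_neq_inr q0 eM eK) => /=.
  by rewrite dvdz1 absz_nat => /eqP q1; rewrite q1 in q_pr.
- exact: (double_completion_iso dK foldl_ foldr_).
- exact: (double_completion_bounded dK foldl_ foldr_).
- apply: (double_not_bounded (t := rotation uv 1) eM eK).
    by rewrite /rot_exponent (modz_nat 1 q) absz_nat modn_mod.
  by rewrite (leq_trans _ q_gt)// addnC.
Qed.
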